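(* Let $\mathbb B\subset\mathbb R^n$ be the open unit ball, $n\ge2$, and $\mathbf I=\{(t,x)\in\mathbb R\times\mathbb R^{n-1}: 0\le t<1,\ |x|=0\}$. For every $p$ with $1\le p<n-1$ there is a homeomorphism $h$ of $\mathbb B$ onto $\mathbb B\setminus\mathbf I$ of finite conformal energy whose inverse $f=h^{-1}$ belongs to $W^{1,p}(\mathbb B\setminus\mathbf I,\mathbb R^n)$.
   Context: A homeomorphism $h\colon\mathbb X\to\mathbb Y$ between bounded domains in $\mathbb R^n$ has finite conformal energy if it is a Sobolev mapping with $\int_{\mathbb X}|Dh(x)|^n\,dx<\infty$, i.e. $h\in W^{1,n}(\mathbb X,\mathbb R^n)$, where $|Dh(x)|$ is the operator norm of the differential matrix. Here $\mathbb R^n$ is identified with $\mathbb R\times\mathbb R^{n-1}$. *)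

(* Defs.v *)
From HB Require Import structures.
From mathcomp Require Import all_boot all_order all_algebra.
From mathcomp Require Import all_classical all_reals all_analysis.

Set Implicit Arguments.
Unset Strict Implicit.
Unset Printing Implicit Defensive.

Import Order.TTheory GRing.Theory Num.Theory.
Import numFieldNormedType.Exports.

Local Open Scope classical_set_scope.
Local Open Scope ring_scope.

(* R^n is 'rV[R]_n. Its library topology, that of the max norm, is the usual
   one; its sigma-algebra below, generated by the coordinates, is the Borel
   one. *)

Definition measure_rV_display : measure_display.
Proof. exact: default_measure_display. Qed.

Section measurable_rV.
Context {R : realType}.
Variable n : nat.

Let coord (i : 'I_n) (x : 'rV[R]_n) : measurableTypeR R := x 0 i.

Let rV_set0 : g_sigma_preimage coord set0.
Proof. exact: sigma_algebra0. Qed.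

Let rV_setC A : g_sigma_preimage coord A -> g_sigma_preimage coord (~` A).
Proof. exact: sigma_algebraC. Qed.

Let rV_bigcup (F : (set 'rV[R]_n)^nat) : (forall i, g_sigma_preimage coord (F i)) ->
  g_sigma_preimage coord (\bigcup_i (F i)).
Proof. exact: sigma_algebra_bigcup. Qed.

HB.instance Definition _ := @isMeasurable.Build measure_rV_display
  'rV[R]_n (g_sigma_preimage coord) rV_set0 rV_setC rV_bigcup.

Lemma measurable_coord (i : 'I_n) :
  measurable_fun [set: 'rV[R]_n] (fun x => x 0 i : measurableTypeR R).
Proof.
move=> _ Y mY; rewrite setTI; apply: sub_sigma_algebra => /=.
rewrite -bigcup_seq/=; exists i => /=; first by rewrite mem_index_enum.
by exists Y => //; rewrite setTI.
Qed.

Lemma measurable_fun_coordP d (T : measurableType d) (f : T -> 'rV[R]_n) :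
  (forall i, measurable_fun setT (fun t => f t 0 i : measurableTypeR R)) ->
  measurable_fun setT f.
Proof.
move=> mf; apply: (@measurability _ _ _ _ _ _
  (\big[setU/set0]_(i < n) preimage_set_system setT (coord i) measurable)) => //.
move=> _ [B + <-]; rewrite -bigcup_seq => -[i /= _ [Y mY <-]].
by rewrite setTI; exact: (mf i measurableT Y mY).
Qed.

End measurable_rV.

Section lebesgue_rV.
Context {R : realType}.

(* the identification of R * R^n with R^(n+1) *)
Definition cons_rV n (p : measurableTypeR R * 'rV[R]_n) : 'rV[R]_n.+1 :=
  \row_i (if unlift ord0 i is Some j then p.2 0 j else p.1 : R).

Lemma measurable_cons_rV n : measurable_fun setT (@cons_rV n).
Proof.
apply: measurable_fun_coordP => i.
have [j ->|->] := unliftP ord0 i.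
  rewrite [X in measurable_fun _ X](_ : _ =
      fun p : measurableTypeR R * 'rV[R]_n => p.2 0 j).
    exact: (measurableT_comp (measurable_coord j) measurable_snd).
  by apply/funext => p; rewrite mxE liftK.
rewrite [X in measurable_fun _ X](_ : _ = fst); first exact: measurable_fst.
by apply/funext => p; rewrite mxE unlift_none.
Qed.

Section step.
Variables (n : nat) (mu : {sigma_finite_measure set 'rV[R]_n -> \bar R}).

Definition lebesgue_rVS : set 'rV[R]_n.+1 -> \bar R :=
  pushforward (lebesgue_measure \x mu)%E (@cons_rV n).

Let mcons := @measurable_cons_rV n.

Let lebesgue_rVS0 : lebesgue_rVS set0 = 0%E.
Proof. exact: measure0. Qed.

Let lebesgue_rVS_ge0 A : (0 <= lebesgue_rVS A)%E.
Proof. exact: measure_ge0. Qed.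

Let lebesgue_rVS_sigma_additive : semi_sigma_additive lebesgue_rVS.
Proof. exact: measure_semi_sigma_additive. Qed.

HB.instance Definition _ := isMeasure.Build _ _ _ lebesgue_rVS
  lebesgue_rVS0 lebesgue_rVS_ge0 lebesgue_rVS_sigma_additive.

Let lebesgue_rVS_sigma_finite : sigma_finite setT lebesgue_rVS.
Proof.
pose uncons (x : 'rV[R]_n.+1) : measurableTypeR R * 'rV[R]_n :=
  (x 0 0, \row_j x 0 (lift ord0 j)).
have unconsK : cancel uncons (@cons_rV n).
  move=> x; apply/rowP => i; rewrite mxE.
  by case: unliftP => [j|] ->; rewrite ?mxE.
have cons_rVK : cancel (@cons_rV n) uncons.
  move=> [t x]; congr pair; first by rewrite mxE unlift_none.
  by apply/rowP => j; rewrite !mxE liftK.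
have muncons : measurable_fun setT uncons.
  apply/measurable_fun_pairP; split.
    exact: measurable_coord.
  apply: measurable_fun_coordP => j.
  rewrite [X in measurable_fun _ X](_ : _ =
      fun x : 'rV[R]_n.+1 => x 0 (lift ord0 j)).
    exact: measurable_coord.
  by apply/funext => x; rewrite mxE.
have /sigma_finiteP[F [FT ndF Foo]] := sigma_finiteT (@lebesgue_measure R).
have /sigma_finiteP[G [GT ndG Goo]] := sigma_finiteT mu.
exists (fun i => uncons @^-1` (F i `*` G i)).
  rewrite -preimage_bigcup (_ : \bigcup_i _ = setT) ?preimage_setT//.
  rewrite -setXTT FT GT predeqE => -[x y]; split.
    by move=> [k _ []/= ? ?]; split; exists k.
  move=> [/= [j _ Fjx] [k _ Gky]]; exists (maxn j k) => //; split.
    by move: x Fjx; exact/subsetPset/ndF/leq_maxl.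
  by move: y Gky; exact/subsetPset/ndG/leq_maxr.
move=> i; have [mF Fi] := Foo i; have [mG Gi] := Goo i; split.
  rewrite -[X in measurable X]setTI; apply: muncons => //.
  exact: measurableX.
rewrite /lebesgue_rVS /pushforward -comp_preimage (_ : _ \o _ = id); last first.
  by apply/funext => q /=.
by rewrite product_measure1E// lte_mul_pinfty// ge0_fin_numE.
Qed.

HB.instance Definition _ := Measure_isSigmaFinite.Build _ _ _
  lebesgue_rVS lebesgue_rVS_sigma_finite.

End step.

Fixpoint lebesgue_rV n : {sigma_finite_measure set 'rV[R]_n -> \bar R} :=
  if n is m.+1 then lebesgue_rVS (lebesgue_rV m) else \d_(0 : 'rV[R]_0).

End lebesgue_rV.

Section sobolev.
Context {R : realType}.
Variable n : nat.

Local Notation Rn := 'rV[R]_n.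
Local Notation mu := (@lebesgue_rV R n).

Definition enorm (x : Rn) : R := Num.sqrt (\sum_i x 0 i ^+ 2).

(* Matrices act on row vectors on the right, as does the library's jacobian. *)
Definition opnorm (A : 'M[R]_n) : R :=
  sup [set enorm (v *m A) | v in [set v | enorm v <= 1]].

Definition partial (i : 'I_n) (u : Rn -> R) : Rn -> R :=
  'D_(delta_mx 0 i) u.

Definition partials (s : seq 'I_n) (u : Rn -> R) : Rn -> R := foldr partial u s.

Definition smooth (u : Rn -> R) := forall s,
  continuous (partials s u) /\
  forall i x, derivable (partials s u) x (delta_mx 0 i).

Definition tsupport (u : Rn -> R) : set Rn := closure [set x | u x != 0].

Definition test_function (Omega : set Rn) (phi : Rn -> R) :=
  [/\ smooth phi, compact (tsupport phi) & tsupport phi `<=` Omega].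

Definition loc_integrable (Omega : set Rn) (u : Rn -> R) :=
  measurable_fun Omega u /\
  forall K, K `<=` Omega -> compact K -> (\int[mu]_(x in K) `|u x|%:E < +oo)%E.

Definition weak_partial (Omega : set Rn) (i : 'I_n) (u g : Rn -> R) :=
  [/\ loc_integrable Omega u, loc_integrable Omega g &
    forall phi, test_function Omega phi ->
      \int[mu]_(x in Omega) (u x * partial i phi x) =
      - \int[mu]_(x in Omega) (g x * phi x)].

Definition weak_differential (Omega : set Rn) (h : Rn -> Rn)
    (Dh : Rn -> 'M[R]_n) :=
  forall i j, weak_partial Omega i (fun x => h x 0 j) (fun x => Dh x i j).

(* h \in W^{1,p}(Omega, R^n), for 1 <= p < +oo; weak_differential includes the
   measurability of h and Dh on Omega. *)
Definition sobolev (Omega : set Rn) (p : R) (h : Rn -> Rn) :=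
  exists Dh, [/\ weak_differential Omega h Dh,
    (\int[mu]_(x in Omega) (enorm (h x) `^ p)%:E < +oo)%E &
    (\int[mu]_(x in Omega) (opnorm (Dh x) `^ p)%:E < +oo)%E].

Definition finite_conformal_energy (Omega : set Rn) (h : Rn -> Rn) :=
  sobolev Omega n%:R h.

(* f only matters on Y, where it is the inverse of h : X -> Y. *)
Definition homeomorphism_with_inverse (X Y : set Rn) (h f : Rn -> Rn) :=
  [/\ set_fun X Y h /\ set_fun Y X f,
      {in X, cancel h f}, {in Y, cancel f h},
      {within X, continuous h} & {within Y, continuous f}].

Definition unit_ball : set Rn := [set x | enorm x < 1].

(* The coordinate of index 0 is the first one, t; the others form x. *)
Definition slit : set Rn := [set z | forall i : 'I_n,
  if i == 0 :> nat then 0 <= z 0 i < 1 else z 0 i == 0].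

End sobolev.

Arguments unit_ball {R n}.
Arguments slit {R n}.

(* Main.v *)
Require Import Defs.
From HB Require Import structures.
From mathcomp Require Import all_boot all_order all_algebra.
From mathcomp Require Import all_classical all_reals all_analysis.
From mathcomp Require Import measurable_realfun ring lra.

Set Implicit Arguments.
Unset Strict Implicit.
Unset Printing Implicit Defensive.

Import Order.TTheory GRing.Theory Num.Theory.
Import numFieldNormedType.Exports.

Local Open Scope classical_set_scope.
Local Open Scope ring_scope.

(** Write z = (t, x) with x in R^m, m = n - 1, and let H be the half-ball of
    the points (a, y) of the unit ball B with a > 0.  The quadratic map
    P (a, y) = (|y|^2 - a^2, 2 a y), which in each half-plane through the axis
    is the complex map w |-> - w^2 up to conjugation, is a bijection of H onto
    B minus the slit: the flat face a = 0 is folded onto the slit.  The ball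
    and the half-ball are bi-Lipschitz equivalent, by a map F : B -> H that is
    given by a closed formula ([fold_map], with inverse [unfold_map]) and is
    differentiable everywhere in the open ball.  Put h = P o F and
    f = F^-1 o P^-1.

    Since P and F are Lipschitz, h is Lipschitz, and its conformal energy is
    finite because B is bounded.

    As P is quadratic, P z - P w = 2 b((z + w)/2, z - w) for a bilinear form b,
    and expanding squares gives |P z - P w| >= (a(z) + a(w)) |z - w|
    ([parab_map_expanding]).  Hence |Df| <= C / a, where a is the height of
    the preimage under P.  On the set where 2^-(k+1) < a <= 2^-k one has
    |x| = 2 a |y| <= 2 2^-k, and the points (t, x) of the ball with this
    property have measure O(2^(-k m)).  So the integral of |Df|^p is at most
    a multiple of the sum of 2^(k (p - m)), which is finite exactly because
    p < m ([dyadic_integral_lt_pinfty]).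

    Both h and f are locally Lipschitz and differentiable at every point of
    an open set; for such functions the classical partial derivatives are weak
    ones ([loc_lipschitz_weak_partial]).  The integration by parts behind this
    says that the integral of a derivative of a compactly supported Lipschitz
    function vanishes, which follows from translation invariance of the
    Lebesgue measure and dominated convergence. *)

(** * Lebesgue measure on row vectors *)

Section measure_rV.
Context {R : realType}.

Lemma normr_coord n (x : 'rV[R]_n) i : `|x 0 i| <= `|x|.
Proof.
rewrite [leRHS]/Num.norm /= mx_normrE.
exact: (@le_bigmax _ _ _ 0 (fun ij : 'I_1 * 'I_n => `|x ij.1 ij.2|) (0, i)).
Qed.

Lemma rV_norm_le n (x : 'rV[R]_n) e :
  0 <= e -> (forall i, `|x 0 i| <= e) -> `|x| <= e.
Proof.
move=> e0 H; rewrite [leLHS]/Num.norm /= mx_normrE; apply/bigmax_leP;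
  split => //.
by move=> [j i] _ /=; rewrite (ord1 j).
Qed.

Definition box n (r : 'I_n -> R) : set 'rV[R]_n :=
  [set x | forall i, `|x 0 i| <= r i].

Lemma measurable_box n (r : 'I_n -> R) : measurable (box r).
Proof.
rewrite (_ : box r = \big[setI/setT]_(i < n)
    (setT `&` (fun x : 'rV[R]_n => x 0 i : measurableTypeR R) @^-1`
       [set` `[- r i, r i]])); last first.
  rewrite -bigcap_seq; apply/seteqP; split => x /=.
    by move=> H i _; split => //=; rewrite in_itv /= -ler_norml.
  move=> H i; have [_ /=] := H i (mem_index_enum i).
  by rewrite in_itv /= -ler_norml.
apply: big_ind => //; first exact: measurableI.
by move=> i _; apply: measurable_coord => //; exact: measurable_itv.
Qed.

(** An open set is the union of the cubes with rational centre and side 2/(k+1)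
    that it contains, and there are countably many of them. *)
Lemma open_measurable_rV n (U : set 'rV[R]_n) : open U -> measurable U.
Proof.
move=> oU.
pose c (q : 'rV[rat]_n) : 'rV[R]_n := map_mx ratr q.
pose cube q k : set 'rV[R]_n := [set x | box (fun=> k.+1%:R^-1) (x - c q)].
have mcube q k : measurable (cube q k).
  have ms : measurable_fun setT (fun x : 'rV[R]_n => x - c q).
    apply: measurable_fun_coordP => i.
    rewrite [X in measurable_fun _ X](_ : _ =
       (fun x : 'rV[R]_n => (x 0 i : measurableTypeR R) + - (c q 0 i))); last
         first.
      by apply/funext => x; rewrite !mxE.
    apply: measurable_funD; last exact: measurable_cst.
    exact: measurable_coord.
  by rewrite -[cube q k]setTI; apply: ms => //; exact: measurable_box.
have -> : U = \bigcup_(qk in [set qk : 'rV[rat]_n * nat | cube qk.1 qk.2 `<=`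
  U])
    cube qk.1 qk.2.
  apply/seteqP; split => [x Ux|x [qk /= + ]]; last exact.
  have /nbhs_ballP [e /= e0 eU] : nbhs x U by exact: open_nbhs_nbhs.
  have [k ke] : exists k : nat, (k.+1%:R^-1 : R) < e / 2.
    have [k _ kP] := near_infty_natSinv_lt (PosNum (divr_gt0 e0 (ltr0n _ 2))).
    by exists k; exact: (kP k (leqnn k)).
  have kq i : exists q : rat, `|x 0 i - ratr q| <= k.+1%:R^-1.
    have xk : x 0 i - k.+1%:R^-1 < x 0 i by rewrite ltrBlDr ltrDl invr_gt0.
    have [q] := rat_in_itvoo xk; rewrite in_itv/= => /andP[q1 q2].
    by exists q; rewrite gtr0_norm ?subr_gt0// lerBlDr -lerBlDl ltW.
  have /choice [q qP] := kq.
  exists (\row_i q i, k) => /=; last by move=> i; rewrite !mxE.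
  move=> y ycube; apply: eU; split=> // j i; rewrite (ord1 j) /ball /=.
  have := ycube i; rewrite !mxE => yq.
  rewrite (_ : x 0 i - y 0 i = (x 0 i - ratr (q i)) - (y 0 i - ratr (q i)));
    last first.
    by rewrite opprB addrA subrK.
  rewrite (le_lt_trans (ler_normB _ _))// [ltRHS]splitr ltrD//.
    exact: le_lt_trans (qP i) ke.
  exact: le_lt_trans yq ke.
rewrite bigcup_mkcond; apply: countable_bigcupT_measurable => [|qk].
  exact: countableP.
by case: ifP => _; [exact: mcube|exact: measurable0].
Qed.

Local Notation mu n := (@lebesgue_rV R n).

Lemma lebesgue_rV_box n (r : 'I_n -> R) : (forall i, 0 <= r i) ->
  mu n (box r) = (\prod_(i < n) (r i *+ 2))%:E.
Proof.
elim: n r => [|n IH] r r0.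
  rewrite big_ord0 /= diracE mem_set//; by case.
rewrite /= /lebesgue_rVS /pushforward /=.
rewrite (_ : _ @^-1` _ = [set` `[- r ord0, r ord0]] `*` box (r \o lift ord0));
  last first.
  apply/seteqP; split => -[t x] /=.
    move=> H; split=> [|j] /=.
      by have := H ord0; rewrite mxE unlift_none /= in_itv/= -ler_norml.
    by have := H (lift ord0 j); rewrite mxE liftK.
  rewrite in_itv /= -ler_norml => -[H1 H2] i; rewrite mxE.
  by case: unliftP => [j|] ->.
rewrite product_measure1E//; last exact: measurable_box.
rewrite [X in (_ * X)%E = _]IH; last by move=> j; exact: r0.
rewrite big_ord_recl EFinM; congr (_ * _)%E.
rewrite [LHS]lebesgue_measure_itv /= lte_fin; case: ifPn => [_|].
  by rewrite -EFinD opprK mulr2n.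
rewrite -leNgt => H; have := r0 ord0; rewrite le_eqVlt => /predU1P[<-|r1].
  by rewrite mul0rn.
by move: H; rewrite leNgt (lt_trans _ r1)// oppr_lt0.
Qed.

(** Both sides are measures that agree on half-open intervals. *)
Lemma lebesgue_measure_shift (c : R) (A : set (measurableTypeR R)) : measurable
    A ->
  lebesgue_measure [set x | A (x + c)] = lebesgue_measure A.
Proof.
move=> mA.
have mc : measurable_fun setT (fun x : measurableTypeR R => x + c :
  measurableTypeR R).
  by apply: measurable_funD.
pose f : {mfun measurableTypeR R >-> measurableTypeR R} :=
  HB.pack (fun x : measurableTypeR R => x + c : measurableTypeR R)
    (isMeasurableFun.Build _ _ _ _ _ mc).
apply/esym.
apply: (@lebesgue_measure_unique R (pushforward (@lebesgue_measure R) f)) => //.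
move=> _ [[a b] _ <-].
transitivity (lebesgue_measure `](a - c), (b - c)]%classic).
  rewrite !lebesgue_measure_itv /= !lte_fin ltrBlDr subrK.
  by case: ifP => // _; rewrite -!EFinD opprB addrA subrK.
by congr lebesgue_measure; apply/seteqP; split => x /=; rewrite !in_itv/=
  ltrBlDr lerBrDr.
Qed.

Lemma measurable_shift n (c : 'rV[R]_n) :
  measurable_fun setT (fun x : 'rV[R]_n => x + c).
Proof.
apply: measurable_fun_coordP => i.
rewrite [X in measurable_fun _ X](_ : _ =
   (fun x : 'rV[R]_n => (x 0 i : measurableTypeR R) + c 0 i)); last first.
  by apply/funext => x; rewrite !mxE.
apply: measurable_funD; last exact: measurable_cst.
exact: measurable_coord.
Qed.

(** By induction on the dimension: the slice of a translate is a translate of a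
    slice, so the claim for the product reduces to the one-dimensional one. *)
Lemma lebesgue_rV_shift n (c : 'rV[R]_n) (A : set 'rV[R]_n) : measurable A ->
  mu n [set x | A (x + c)] = mu n A.
Proof.
elim: n c A => [|n IH] c A mA.
  by congr (mu 0 _); apply/funext => x /=; congr (A _); apply/rowP; case.
rewrite /= /lebesgue_rVS /pushforward /product_measure1 /=.
set F := fun x => mu n (xsection (@cons_rV R n @^-1` A) x).
have mcA : measurable (@cons_rV R n @^-1` A).
  by rewrite -[X in measurable X]setTI; apply: measurable_cons_rV.
transitivity (\int[@lebesgue_measure R]_x F (x + c 0 0 : measurableTypeR
  R)%R)%E.
  apply: eq_integral => x _; rewrite /F /=.
  have mB := measurable_xsection (x + c 0 0 : measurableTypeR R) mcA.
  rewrite -(IH (\row_j c 0 (lift ord0 j)) _ mB).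
  congr (mu n _); apply/funext => y /=; rewrite /xsection /=; apply/propext.
  rewrite !inE /=.
  suff -> : cons_rV (x, y) + c =
    cons_rV (x + c 0 0 : measurableTypeR R, y + \row_j c 0 (lift ord0 j)) by [].
  by apply/rowP => i; rewrite !mxE; case: unliftP => [j|] ->; rewrite ?mxE.
have mc : measurable_fun setT (fun x : measurableTypeR R => x + c 0 0 :
  measurableTypeR R).
  by apply: measurable_funD.
have mF : measurable_fun setT F by exact: measurable_fun_xsection.
rewrite -(@ge0_integral_pushforward _ _ _ _ _ _ mc lebesgue_measure setT F)//.
pose f : {mfun measurableTypeR R >-> measurableTypeR R} :=
  HB.pack (fun x : measurableTypeR R => x + c 0 0 : measurableTypeR R)
    (isMeasurableFun.Build _ _ _ _ _ mc).
apply: (eq_measure_integral (@lebesgue_measure R) (m1:=pushforward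
  (@lebesgue_measure R) f)) => B mB _.
exact: lebesgue_measure_shift.
Qed.

Lemma Rintegral_shift n (c : 'rV[R]_n) (f : 'rV[R]_n -> R) :
  (mu n).-integrable setT (EFin \o f) ->
  (mu n).-integrable setT (EFin \o (fun x => f (x + c))) /\
  \int[mu n]_x f (x + c) = \int[mu n]_x f x.
Proof.
move=> fi.
have mf : measurable_fun setT f by move/measurable_int : fi =>
  /measurable_EFinP.
have ms := measurable_shift c.
pose s : {mfun 'rV[R]_n >-> 'rV[R]_n} :=
  HB.pack (fun x : 'rV[R]_n => x + c) (isMeasurableFun.Build _ _ _ _ _ ms).
have E (g : 'rV[R]_n -> \bar R) :
    (\int[pushforward (mu n) s]_x g x = \int[mu n]_x g x)%E.
  by apply: eq_measure_integral => B mB _; exact: lebesgue_rV_shift.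
have fci : (mu n).-integrable setT (EFin \o (fun x => f (x + c))).
  apply/integrableP; split.
    by apply/measurable_EFinP; exact: measurableT_comp.
  move/integrableP : fi => [_]; rewrite -E => H.
  apply: le_lt_trans H.
  rewrite (@ge0_integral_pushforward _ _ _ _ _ _ ms)//.
  by apply: measurableT_comp => //; apply/measurable_EFinP.
split => //.
rewrite /Rintegral; congr fine; rewrite -[RHS]E.
have mEf : measurable_fun setT (EFin \o f) by exact/measurable_EFinP.
exact: (esym (integral_pushforward ms mEf fci measurableT)).
Qed.

End measure_rV.

(** * Weak derivatives of locally Lipschitz functions *)

Section locally_lipschitz.
Context {R : realType} {n : nat}.
Local Notation Rn := 'rV[R]_n.
Local Notation mu := (@lebesgue_rV R n).
Implicit Types (Omega K : set Rn) (u : Rn -> R).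

Lemma compact_sub_box K : compact K -> exists2 r : R, 0 <=
    r & K `<=` box (fun=> r).
Proof.
move=> /compact_bounded [M [Mreal KM]]; exists (`|M| + 1);
  first by rewrite addr_ge0.
move=> x Kx i; apply: le_trans (normr_coord _ _) _;
  apply: (KM (`|M| + 1)) => //.
by rewrite ltr_pwDr// ler_norm.
Qed.

Lemma compact_measurable_rV K : compact K -> measurable K.
Proof.
move=> cK; have oK : open (~` K).
  exact/closed_openC/(compact_closed (@norm_hausdorff R Rn) cK).
by rewrite -[K]setCK; apply: measurableC; exact: open_measurable_rV.
Qed.

Lemma lebesgue_rV_sub_box K r : 0 <= r -> measurable K ->
    K `<=` box (fun=> r) ->
  (mu K < +oo)%E.
Proof.
move=> r0 mK Kr; apply: (@le_lt_trans _ _ (mu (box (fun=> r)))).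
  by apply: le_measure => //; rewrite inE//; exact: measurable_box.
by rewrite lebesgue_rV_box// ltry.
Qed.

Lemma bounded_supp_integrable (f : Rn -> R) r M : 0 <= r ->
  measurable_fun setT f -> (forall x, `|f x| <= M) ->
  (forall x, ~ box (fun=> r) x -> f x = 0) ->
  mu.-integrable setT (EFin \o f).
Proof.
move=> r0 mf fM f0.
have mb := @measurable_box R n (fun=> r).
rewrite (_ : EFin \o f = (EFin \o f) \_ (box (fun=> r))); last first.
  apply/funext => x; rewrite patchE; case: ifPn => // xB.
  by rewrite /= f0// => xb; move: xB; rewrite mem_set.
apply/(integrable_mkcond _ mb); apply: measurable_bounded_integrable => //.
- exact: lebesgue_rV_sub_box r0 _ _.
- exact: measurable_funTS.
- exists M; split; first exact: num_real.
  by move=> y My x _ /=; apply: le_trans (fM x) (ltW My).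
Qed.

Lemma continuous_on_measurable Omega u : open Omega ->
  (forall x, Omega x -> {for x, continuous u}) -> measurable_fun Omega u.
Proof.
move=> oO cu.
apply: (measurability _ (RGenOpens.measurableE R)) => /=.
move=> _ [_ [a [b ->] <-]].
apply: open_measurable_rV; rewrite openE => x [Ox uab].
apply: filterI; first exact: open_nbhs_nbhs.
by apply: (cu x Ox); apply: open_nbhs_nbhs; split => //; exact: interval_open.
Qed.

(** Only the first point is confined to K.  Thus the difference quotients at a
    point of K are controlled even when they leave K, and the constant may
    blow up at the boundary of Omega, as it does for f. *)
Definition loc_lipschitz Omega u := forall K, compact K -> K `<=` Omega ->
  exists L, forall x y, K x -> Omega y -> `|u x - u y| <= L * `|x - y|.

Lemma loc_lipschitz_continuous Omega u : open Omega -> loc_lipschitz Omega u ->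
  forall x, Omega x -> {for x, continuous u}.
Proof.
move=> oO Lu x Ox.
have [|L LP] := Lu [set x] (@compact_set1 _ x); first by move=> _ ->.
have Fx : Filter (nbhs x) := nbhs_filter x.
rewrite /prop_for /continuous_at; apply/(@cvgrPdist_le _ _ _ (nbhs x)) => e e0
  /=.
have L1 : 0 < `|L| + 1 by rewrite ltr_wpDl.
near=> y.
have Oy : Omega y by near: y; exact: open_nbhs_nbhs.
apply: le_trans (LP x y erefl Oy) _.
apply: (@le_trans _ _ ((`|L| + 1) * `|x - y|)).
  by apply: ler_wpM2r => //; rewrite ler_wpDr// ler_norm.
rewrite -ler_pdivlMl//; near: y.
by apply: cvgr_dist_le => //; rewrite mulr_gt0// invr_gt0.
Unshelve. all: by end_near. Qed.

Lemma diffquot_cvg u x v : derivable u x v ->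
  (fun k => k.+1%:R * (u (x + k.+1%:R^-1 *: v) - u x)) @ \oo --> 'D_v u x.
Proof.
move=> du.
have /cvgr_dnbhsP := (du : (fun h => h^-1 *: ((u \o shift x) (h *: v) - u x)) @
  0^' --> 'D_v u x).
move=> /(_ (fun k => k.+1%:R^-1)) H.
have : (fun k => (k.+1%:R^-1 : R)^-1 *: ((u \o shift x) (k.+1%:R^-1 *: v) - u
  x)) @ \oo --> 'D_v u x.
  apply: H; split; first by move=> k; rewrite invr_neq0.
  exact: cvg_harmonic.
apply: cvg_trans; apply: near_eq_cvg; near=> k => /=.
by rewrite invrK (addrC x).
Unshelve. all: by end_near. Qed.

End locally_lipschitz.

Section derivative_bounds.
Context {R : realType} {n : nat}.
Local Notation Rn := 'rV[R]_n.
Local Notation mu := (@lebesgue_rV R n).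
Implicit Types (Omega K : set Rn) (u : Rn -> R).

Lemma continuous_compact_bounded (g : Rn -> R) K : compact K ->
  (forall x, K x -> {for x, continuous g}) -> exists2 M, 0 <= M & forall x,
    K x -> `|g x| <= M.
Proof.
move=> cK cg; have : compact (g @` K).
  apply: continuous_compact => //; apply: continuous_in_subspaceT => x.
  by rewrite inE => /cg.
move=> /compact_bounded [M [Mreal KM]]; exists (`|M| + 1);
  first by rewrite addr_ge0.
by move=> x Kx; apply: (KM (`|M| + 1)); [rewrite ltr_pwDr// ler_norm|exists x].
Qed.

Lemma loc_lipschitz_bounded Omega u K : loc_lipschitz Omega u -> compact K ->
  K `<=` Omega -> exists2 M, 0 <= M & forall x, K x -> `|u x| <= M.
Proof.
move=> Lu cK KO; have [L LP] := Lu K cK KO.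
have [[x0 Kx0]|K0] := pselect (exists x, K x); last first.
  by exists 0 => // x Kx; exfalso; apply: K0; exists x.
have [r r0 Kr] := compact_sub_box cK.
have nr x : K x -> `|x| <= r by move=> Kx; apply: rV_norm_le => //; exact: Kr.
exists (`|u x0| + `|L| * (r + r)); first by rewrite addr_ge0// mulr_ge0//
  addr_ge0.
move=> x Kx; rewrite -[u x](subrK (u x0)) addrC.
apply: le_trans (ler_normD _ _) _; rewrite lerD2l.
apply: le_trans (LP x x0 Kx (KO _ Kx0)) _.
apply: (@le_trans _ _ (`|L| * `|x - x0|)); first by rewrite ler_wpM2r//
  ler_norm.
by rewrite ler_wpM2l// (le_trans (ler_normB _ _))// lerD// nr.
Qed.

(** The derivative is a limit of difference quotients, each at most L |v|. *)
Lemma normr_derive_le u x v L : derivable u x v ->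
  (\forall y \near x, `|u y - u x| <= L * `|y - x|) -> `|'D_v u x| <= L * `|v|.
Proof.
move=> du Hx.
have H := cvg_norm (diffquot_cvg du).
have H2 : (fun _ : nat => L * `|v|) @ \oo --> L * `|v| by exact: cvg_cst.
suff H3 : \forall k \near \oo, `|k.+1%:R * (u (x + k.+1%:R^-1 *: v) - u x)| <=
  L * `|v|.
  exact: ler_cvg_to (H _) H2 H3.
have xk : (fun k => x + k.+1%:R^-1 *: v) @ \oo --> x.
  rewrite -[X in _ --> X](addr0 x) -[X in _ --> _ + X](scale0r v).
  apply: cvgD; first exact: cvg_cst.
  by apply: cvgZr_tmp; exact: cvg_harmonic.
have : \forall k \near \oo, `|u (x + k.+1%:R^-1 *: v) - u x| <=
  L * `|x + k.+1%:R^-1 *: v - x|.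
  exact: xk Hx.
apply: filterS => k Hk; rewrite normrM ger0_norm//.
rewrite mulrC -ler_pdivlMr// (le_trans Hk)//.
by rewrite addrC addKr normrZ ger0_norm ?invr_ge0// mulrA mulrAC.
Qed.

Lemma bounded_loc_integrable Omega u : measurable_fun Omega u ->
    measurable Omega ->
  (forall K, compact K -> K `<=` Omega -> exists M, forall x, K x -> `|u x| <=
    M) ->
  loc_integrable Omega u.
Proof.
move=> mu_ mO bu; split => // K KO cK.
have [M MP] := bu K cK KO.
have [r r0 Kr] := compact_sub_box cK.
have mK := compact_measurable_rV cK.
have : mu.-integrable K (EFin \o u).
  apply: measurable_bounded_integrable => //.
  - exact: lebesgue_rV_sub_box r0 _ _.
  - exact: measurable_funS mu_.
  - exists M; split; first exact: num_real.
    by move=> y My x Kx /=; apply: le_trans (MP x Kx) (ltW My).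
by move=> /integrableP [].
Qed.

Lemma is_derive_line (phi : Rn -> R) x v (h : R) :
  derivable phi (h *: v + x) v ->
  is_derive h (1 : R) (fun h => phi (h *: v + x)) ('D_v phi (h *: v + x)).
Proof.
have E : (fun k => k^-1 *: (((fun h => phi (h *: v + x)) \o shift h) (k *: (1 :
  R)) - phi (h *: v + x)))
  = (fun k => k^-1 *: ((phi \o shift (h *: v + x)) (k *: v) - phi (h *: v +
    x))).
  apply/funext => k /=; congr (_ *: (phi _ - _)).
  by rewrite [k *: 1]mulr1 scalerDl addrA.
move=> d; apply: DeriveDef.
  by rewrite /derivable E.
by rewrite /derive E.
Qed.

Lemma derive_bounded_lipschitz (phi : Rn -> R) v M :
  (forall x, derivable phi x v) -> (forall x, `|'D_v phi x| <= M) ->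
  forall x t, 0 <= t -> `|phi (x + t *: v) - phi x| <= M * t.
Proof.
move=> d b x t t0.
pose f h := phi (h *: v + x).
have df h : is_derive h (1 : R) f ('D_v phi (h *: v + x)) by exact:
  is_derive_line.
have [|c _ E] := @MVT_segment R f (fun h => 'D_v phi (h *: v + x)) 0 t t0 (fun
  h _ => df h).
  apply: continuous_subspaceT => h.
  by apply: differentiable_continuous; apply/derivable1_diffP; case: (df h).
rewrite /f scale0r add0r in E; rewrite (addrC x) E subr0 normrM (ger0_norm t0).
by rewrite ler_wpM2r.
Qed.

End derivative_bounds.

Section weak_derivative.
Context {R : realType} {n : nat}.
Local Notation Rn := 'rV[R]_n.
Local Notation mu := (@lebesgue_rV R n).
Implicit Types (Omega K : set Rn) (u : Rn -> R).

(** The difference quotients of g have integral 0, by translation invariance.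
    They are bounded by C, supported in a slightly larger box, and converge to
    the derivative, so dominated convergence applies. *)
Lemma Rintegral_derive_eq0 (g : Rn -> R) v r C : 0 <= r -> `|v| <= 1 ->
  measurable_fun setT g ->
  (forall x, ~ box (fun=> r) x -> g x = 0) ->
  (forall x t, 0 <= t -> `|g (x + t *: v) - g x| <= C * t) ->
  (forall x, `|g x| <= C) ->
  (forall x, derivable g x v) ->
  \int[mu]_x 'D_v g x = 0.
Proof.
move=> r0 v1 mg g0 gL gC dg.
have gi : mu.-integrable setT (EFin \o g) by exact: bounded_supp_integrable r0
  mg gC g0.
pose D (k : nat) x := k.+1%:R * (g (x + k.+1%:R^-1 *: v) - g x).
have mD k : measurable_fun setT (D k).
  apply: measurable_funM => //; apply: measurable_funB => //.
  exact: measurableT_comp mg (measurable_shift _).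
have DC k x : `|D k x| <= C.
  rewrite normrM ger0_norm// mulrC -ler_pdivlMr//.
  by apply: gL; rewrite invr_ge0.
have D0 k x : ~ box (fun=> r + 1) x -> D k x = 0.
  move=> xb; rewrite /D !g0 ?subrr ?mulr0//.
    by move=> H; apply: xb => i; rewrite (le_trans (H i))// lerDl.
  move=> H; apply: xb => i.
  have := H i; rewrite !mxE => Hi.
  rewrite -[x 0 i](addrK (k.+1%:R^-1 * v 0 i)) (le_trans (ler_normB _ _))//
    lerD//.
  rewrite normrM ger0_norm ?invr_ge0// mulr_ile1 ?invr_ge0//.
    by rewrite invf_le1// ler1n.
  exact: le_trans (normr_coord v i) v1.
have r10 : 0 <= r + 1 by rewrite addr_ge0.
have Di k : mu.-integrable setT (EFin \o D k).
  exact: bounded_supp_integrable r10 (mD k) (DC k) (D0 k).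
have ID k : (\int[mu]_x (D k x)%:E = 0)%E.
  rewrite -[LHS]fineK; last exact: (integrable_fin_num measurableT (Di k)).
  rewrite -[fine _]/(\int[mu]_x (D k x)) /D.
  have [gsi gsE] := Rintegral_shift (k.+1%:R^-1 *: v) gi.
  rewrite RintegralZl//.
    by rewrite RintegralB// gsE subrr mulr0.
  exact: (integrableB measurableT gsi gi).
pose dom : Rn -> R := (fun x => C * \1_(box (fun=> r + 1)) x).
have mb := @measurable_box R n (fun=> r + 1).
have domi : mu.-integrable setT (EFin \o dom).
  apply: (@bounded_supp_integrable _ _ dom (r + 1) C) => //.
  - by apply: measurable_funM => //; exact: measurable_indic.
  - move=> x; rewrite /dom normrM indicE.
    have C0 : 0 <= C by exact: le_trans (gC x).
    by case: (_ \in _); rewrite ?normr1 ?normr0 ?mulr1 ?mulr0 ?ger0_norm.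
  - by move=> x xb; rewrite /dom indicE memNset// mulr0.
have Dcvg x : D ^~ x @ \oo --> 'D_v g x by exact: diffquot_cvg.
have mDg : measurable_fun setT ('D_v g).
  by apply: (measurable_fun_cvg mD) => x _; exact: Dcvg.
have [] := @dominated_convergence _ _ _ mu setT measurableT
  (fun k => EFin \o D k) (EFin \o 'D_v g) (EFin \o dom).
- by move=> k; apply/measurable_EFinP.
- exact/measurable_EFinP.
- by apply: aeW => x _; apply/fine_cvgP; split; [exact: nearW|exact: Dcvg].
- exact: domi.
- apply: aeW => x k _; rewrite /= lee_fin /dom indicE.
  have [xb|xb] := pselect (box (fun=> r + 1) x).
    by rewrite mem_set// mulr1.
  by rewrite D0// normr0 memNset// mulr0.
move=> _ _.
rewrite (_ : (fun _ => _) = cst 0%E); last by apply/funext => k; exact: ID.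
move=> /cvg_lim; rewrite lim_cst// => H.
by rewrite /Rintegral -[X in fine X]H.
Qed.

(** For a test function phi, the product u phi, extended by 0, is Lipschitz in
    the direction v, and its derivative is u D_v phi + (D_v u) phi on Omega and
    0 elsewhere.  The integral of that derivative vanishes. *)
Lemma loc_lipschitz_weak_partial Omega (i : 'I_n) u : open Omega ->
  loc_lipschitz Omega u ->
  (forall x, Omega x -> derivable u x (delta_mx 0 i)) ->
  weak_partial Omega i u ('D_(delta_mx 0 i) u).
Proof.
move=> oO Lu du; set v : Rn := delta_mx 0 i.
have v1 : `|v| <= 1.
  apply: rV_norm_le => // j; rewrite mxE /=.
  by case: (_ == _); rewrite ?normr1 ?normr0.
have mO := open_measurable_rV oO.
have cu := loc_lipschitz_continuous oO Lu.
have mu_ : measurable_fun Omega u by exact: continuous_on_measurable.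
(* extended by 0, u is measurable and has difference quotients everywhere *)
pose w := u \_ Omega.
have wE x : Omega x -> w x = u x by move=> Ox; rewrite /w patchE mem_set.
have mw : measurable_fun setT w by apply/(measurable_restrictT _ mO).
have near_w x : Omega x -> \forall y \near x, u y = w y.
  move=> Ox; have : nbhs x Omega by exact: open_nbhs_nbhs.
  by apply: filterS => y /wE.
have dw x : Omega x -> derivable w x v.
  by move=> Ox; apply: near_eq_derivable (du x Ox); exact: near_w.
have dwE x : Omega x -> 'D_v w x = 'D_v u x.
  by move=> Ox; apply/esym/near_eq_derive; exact: near_w.
have mDu : measurable_fun Omega ('D_v u).
  pose D (k : nat) (x : Rn) : R := k.+1%:R * (w (x + k.+1%:R^-1 *: v) - w x).
  have mD k : measurable_fun Omega (D k).
    apply: measurable_funTS; apply: measurable_funM => //.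
    apply: measurable_funB => //.
    exact: measurableT_comp mw (measurable_shift _).
  apply: (measurable_fun_cvg mD) => x Ox.
  by rewrite -dwE//; apply: diffquot_cvg; exact: dw.
have bDu K : compact K -> K `<=` Omega -> exists M, forall x, K x ->
  `|'D_v u x| <= M.
  move=> cK KO; have [L LP] := Lu K cK KO.
  exists (L * `|v|) => x Kx; apply: normr_derive_le; first exact/du/KO.
  have : nbhs x Omega by apply: open_nbhs_nbhs; split => //; exact: KO.
  apply: filterS => y Oy; rewrite distrC [in leRHS]distrC; exact: LP.
split.
- apply: bounded_loc_integrable => // K cK KO.
  by have [M _ MP] := loc_lipschitz_bounded Lu cK KO; exists M.
- exact: bounded_loc_integrable.
move=> phi [sphi cK KO].
set K := tsupport phi in cK KO.
have cphi : continuous phi by have [] := sphi [::].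
have dphi x : derivable phi x v by have [_] := sphi [::]; exact.
have cdphi : continuous ('D_v phi) by have [] := sphi [:: i].
have phi0 x : ~ K x -> phi x = 0.
  move=> Kx; apply/eqP/negPn/negP => H; apply: Kx.
  exact: (@subset_closure _ [set x | phi x != 0]).
have nK x : ~ K x -> \forall y \near x, ~ K y.
  move=> Kx; apply: open_nbhs_nbhs; split => //.
  by apply: closed_openC; exact: closed_closure.
have dphi0 x : ~ K x -> 'D_v phi x = 0.
  move=> /nK Kx; rewrite -[RHS](derive_cst (0 : R) x v); apply: near_eq_derive.
  by apply: filterS Kx => y /phi0.
have [M1 M10 M1P] := continuous_compact_bounded cK (fun x _ => cphi x).
have [M2 M20 M2P] := continuous_compact_bounded cK (fun x _ => cdphi x).
have M1a x : `|phi x| <= M1.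
  by have [/M1P//|/phi0 ->] := pselect (K x); rewrite normr0.
have M2a x : `|'D_v phi x| <= M2.
  by have [/M2P//|/dphi0 ->] := pselect (K x); rewrite normr0.
have phiL := derive_bounded_lipschitz dphi M2a.
have [B B0 BP] := loc_lipschitz_bounded Lu cK KO.
have [L LP] := Lu K cK KO.
have [r r0 Kr] := compact_sub_box cK.
have [M3 M3P] := bDu K cK KO.
pose g : Rn -> R := fun x => w x * phi x.
have nKr x : ~ box (fun=> r) x -> ~ K x by move=> H /Kr.
have mphi : measurable_fun setT phi.
  by apply: continuous_on_measurable; [exact: openT|move=> x _; exact: cphi].
have mdphi : measurable_fun setT ('D_v phi).
  by apply: continuous_on_measurable; [exact: openT|move=> x _; exact: cdphi].
have mDw : measurable_fun setT ('D_v u \_ Omega) by apply/(measurable_restrictT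
  _ mO).
have DwE x : Omega x -> ('D_v u \_ Omega) x = 'D_v u x.
  by move=> Ox; rewrite patchE mem_set.
have dgx x : derivable g x v /\
    'D_v g x = w x * 'D_v phi x + ('D_v u \_ Omega) x * phi x.
  have [Ox|nOx] := pselect (Omega x); last first.
    have nKx : ~ K x by move=> /KO.
    have Hg : \forall y \near x, cst (0 : R) y = g y.
      by apply: filterS (nK x nKx) => y /phi0 /= py; rewrite /g py mulr0.
    split; first exact: (near_eq_derivable Hg (derivable_cst _ _ _)).
    rewrite -(near_eq_derive v Hg) derive_cst.
    by rewrite phi0// dphi0// !mulr0 addr0.
  split; first exact: (derivableM (dw x Ox) (dphi x)).
  rewrite [LHS](deriveM (dw x Ox) (dphi x)) dwE// DwE//.
  by congr (_ + _); rewrite mulrC.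
have i1 : mu.-integrable setT (EFin \o (fun x => w x * 'D_v phi x)).
  apply: (@bounded_supp_integrable _ _ _ r (B * M2)) => //.
  - exact: measurable_funM.
  - move=> x; have [Kx|/dphi0 ->] := pselect (K x).
      by rewrite normrM ler_pM// wE; [exact: BP|exact: KO].
    by rewrite mulr0 normr0 mulr_ge0.
  - by move=> x /nKr /dphi0 ->; rewrite mulr0.
have i2 : mu.-integrable setT (EFin \o (fun x => ('D_v u \_ Omega) x * phi x)).
  apply: (@bounded_supp_integrable _ _ _ r (`|M3| * M1)) => //.
  - exact: measurable_funM.
  - move=> x; have [Kx|/phi0 ->] := pselect (K x).
      rewrite normrM ler_pM// DwE; last exact: KO.
      by apply: le_trans (M3P x Kx) _; exact: ler_norm.
    by rewrite mulr0 normr0 mulr_ge0.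
  - by move=> x /nKr /phi0 ->; rewrite mulr0.
(* if one of the two points is outside K then phi vanishes there, and the
   increment of u does not enter *)
have gL x t : 0 <= t -> `|g (x + t *: v) - g x| <= (`|L| * M1 + B * M2) * t.
  move=> t0; set y := x + t *: v.
  have Ht : `|phi y - phi x| <= M2 * t by exact: phiL.
  have [Kx|nKx] := pselect (K x); have [Ky|nKy] := pselect (K y).
  - rewrite /g (wE _ (KO _ Kx)) (wE _ (KO _ Ky)).
    rewrite (_ : _ - _ = (u y - u x) * phi y + u x * (phi y - phi x)); last
      by ring.
    rewrite [leRHS]mulrDl (le_trans (ler_normD _ _))// lerD//.
      rewrite normrM mulrAC ler_pM//.
      apply: le_trans (LP y x Ky (KO _ Kx)) _;
        rewrite /y (addrC x) addrK normrZ.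
      apply: (@le_trans _ _ (`|L| * (`|t| * `|v|))).
        by rewrite ler_wpM2r ?mulr_ge0// ler_norm.
      by rewrite ler_wpM2l// (ger0_norm t0) ler_piMr.
    by rewrite normrM -mulrA ler_pM//; exact: BP.
  - have -> : g y - g x = u x * (phi y - phi x).
      by rewrite /g (phi0 y)// mulr0 (wE _ (KO _ Kx)); ring.
    rewrite [leRHS]mulrDl ler_wpDl ?mulr_ge0//.
    by rewrite normrM -mulrA ler_pM//; exact: BP.
  - have -> : g y - g x = u y * (phi y - phi x).
      by rewrite /g (phi0 x)// mulr0 (wE _ (KO _ Ky)); ring.
    rewrite [leRHS]mulrDl ler_wpDl ?mulr_ge0//.
    by rewrite normrM -mulrA ler_pM//; exact: BP.
  - by rewrite /g !phi0// !mulr0 subrr normr0 mulr_ge0// addr_ge0// mulr_ge0.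
have gC x : `|g x| <= B * M1.
  rewrite /g; have [Kx|/phi0 ->] := pselect (K x).
    by rewrite normrM ler_pM// wE; [exact: BP|exact: KO].
  by rewrite mulr0 normr0 mulr_ge0.
have : \int[mu]_x 'D_v g x = 0.
  apply: (@Rintegral_derive_eq0 _ _ r (`|L| * M1 + B * M2 + B * M1)) => //.
  - exact: measurable_funM.
  - by move=> x /nKr /phi0 H; rewrite /g H mulr0.
  - move=> x t t0; apply: le_trans (gL x t t0) _.
    by rewrite ler_wpM2r// lerDl mulr_ge0.
  - move=> x; apply: le_trans (gC x) _.
    by rewrite lerDr addr_ge0// mulr_ge0.
  - by move=> x; have [] := dgx x.
rewrite (_ : (fun _ => _) = (fun x => w x * 'D_v phi x + ('D_v u \_ Omega) x *
  phi x)); last first.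
  by apply/funext => x; have [] := dgx x.
rewrite RintegralD// => /eqP; rewrite addr_eq0 => /eqP H.
rewrite Rintegral_mkcond [in RHS]Rintegral_mkcond.
rewrite (_ : _ \_ Omega = (fun x => w x * 'D_v phi x)); last first.
  apply/funext => x; rewrite /w !patchE; case: ifPn => //; by rewrite mul0r.
rewrite H; congr (- _); congr (Rintegral _ _ _).
by apply/funext => x; rewrite !patchE; case: ifPn => //; rewrite mul0r.
Qed.

End weak_derivative.

(** * Scalar formulas for the maps *)

Section scalars.
Context {R : realType}.
Implicit Types a b c d t N T : R.

Lemma ler_dist_sqrt k a b : 0 < k -> k <= a -> k <= b ->
  `|Num.sqrt a - Num.sqrt b| <= (Num.sqrt k)^-1 * `|a - b|.
Proof.
move=> k0 ka kb.
have sk : 0 < Num.sqrt k by rewrite sqrtr_gt0.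
have a0 : 0 <= a by exact: le_trans (ltW k0) ka.
have b0 : 0 <= b by exact: le_trans (ltW k0) kb.
have ska : Num.sqrt k <= Num.sqrt a by rewrite ler_sqrt.
have Eab : a - b = (Num.sqrt a - Num.sqrt b) * (Num.sqrt a + Num.sqrt b).
  by rewrite -subr_sqr !sqr_sqrtr.
rewrite ler_pdivlMl// [in leRHS]Eab normrM mulrC ler_wpM2l//.
by rewrite ger0_norm ?addr_ge0 ?sqrtr_ge0// (le_trans ska)// lerDl sqrtr_ge0.
Qed.

Lemma hypot_le a b c d : Num.sqrt (a ^+ 2 + b ^+ 2) <=
  Num.sqrt (c ^+ 2 + d ^+ 2) + (`|a - c| + `|b - d|).
Proof.
set s := Num.sqrt (c ^+ 2 + d ^+ 2).
have s0 : 0 <= s by exact: sqrtr_ge0.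
have s2 : s ^+ 2 = c ^+ 2 + d ^+ 2 by rewrite sqr_sqrtr// addr_ge0// sqr_ge0.
have cs : `|c| <= s.
  by rewrite -[`|c|]sqrtr_sqr /s ler_wsqrtr// lerDl sqr_ge0.
have ds : `|d| <= s.
  by rewrite -[`|d|]sqrtr_sqr /s ler_wsqrtr// lerDr sqr_ge0.
have e0 := normr_ge0 (a - c); have f0 := normr_ge0 (b - d).
rewrite -[leRHS]ger0_norm; last by rewrite addr_ge0// addr_ge0.
rewrite -sqrtr_sqr ler_wsqrtr//.
have Ha : a ^+ 2 <= (`|c| + `|a - c|) ^+ 2.
  rewrite -[a ^+ 2]real_normK ?num_real// ler_pXn2r ?nnegrE ?addr_ge0//.
  by rewrite -[X in `|X| <= _](subrK c) addrC ler_normD.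
have Hb : b ^+ 2 <= (`|d| + `|b - d|) ^+ 2.
  rewrite -[b ^+ 2]real_normK ?num_real// ler_pXn2r ?nnegrE ?addr_ge0//.
  by rewrite -[X in `|X| <= _](subrK d) addrC ler_normD.
have c2 : `|c| ^+ 2 = c ^+ 2 by rewrite real_normK ?num_real.
have d2 : `|d| ^+ 2 = d ^+ 2 by rewrite real_normK ?num_real.
move: Ha Hb; move: (`|a - c|) (`|b - d|) (`|c|) (`|d|) e0 f0 cs ds c2 d2 => e f
  C D.
move=> e0 f0 cs ds c2 d2 Ha Hb.
have P1 : 0 <= (s - C) * e by rewrite mulr_ge0// subr_ge0.
have P2 : 0 <= (s - D) * f by rewrite mulr_ge0// subr_ge0.
have P3 : 0 <= e * f by rewrite mulr_ge0.
nra.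
Qed.

Lemma ler_dist_hypot a b c d :
  `|Num.sqrt (a ^+ 2 + b ^+ 2) - Num.sqrt (c ^+ 2 + d ^+ 2)| <=
    `|a - c| + `|b - d|.
Proof.
rewrite ler_norml; apply/andP; split.
  by rewrite lerBrDl lerBlDr (distrC a) (distrC b) hypot_le.
by rewrite lerBlDl hypot_le.
Qed.

(** x y / (x + y) has slope (y / (x + y))^2 <= 1 in x; this keeps the estimate
    uniform up to the corner x = y = 0. *)
Lemma ler_dist_harmonic a b c d : 0 < a -> 0 < b -> 0 < c -> 0 < d ->
  `|a * b / (a + b) - c * d / (c + d)| <= `|a - c| + `|b - d|.
Proof.
have one (x x' y : R) : 0 < x -> 0 < x' -> 0 < y ->
    `|x * y / (x + y) - x' * y / (x' + y)| <= `|x - x'|.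
  move=> x0 x'0 y0.
  have xy : 0 < x + y by rewrite addr_gt0.
  have x'y : 0 < x' + y by rewrite addr_gt0.
  have -> : x * y / (x + y) - x' * y / (x' + y) =
      (y / (x + y)) * (y / (x' + y)) * (x - x').
    by field; rewrite !gt_eqF.
  have frac z : 0 < z -> `|y / (z + y)| <= 1.
    move=> z0; have zy : 0 < z + y by rewrite addr_gt0.
    rewrite ger0_norm; last by apply: divr_ge0; exact: ltW.
    by rewrite ler_pdivrMr// mul1r lerDr ltW.
  by rewrite normrM ler_piMl// normrM mulr_ile1// frac.
move=> a0 b0 c0 d0.
rewrite (_ : _ - _ = (a * b / (a + b) - c * b / (c + b)) +
  (b * c / (b + c) - d * c / (d + c))); last first.
  by rewrite (mulrC b c) (addrC b c) (mulrC d c) (addrC d c); ring.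
by rewrite (le_trans (ler_normD _ _))// lerD// one.
Qed.

(** The map F.  All maps below send (t, x) to
    (T, c x), where T and c depend on t and N = |x|^2 only; what follows are
    these functions of (t, N).

    The boundary of H consists of a flat and a round face, which meet at a
    right angle.  Opening this angle is modelled on the map
    (p, q) |-> (p - q, 2 p q / (p + q)) of the quarter-plane onto the upper
    half-plane, with inverse p = (V + u + s) / 2, q = (V - u + s) / 2, where
    s = sqrt (u^2 + V^2).  It is bi-Lipschitz up to the corner, since norms and
    harmonic means are Lipschitz.  Here u = t is the height in the ball, and
    V = (1 - |z|^2) / 2 ([ball_depth]) vanishes on the sphere.  This choice
    gives N = (1 - V - s) (1 - V + s), so that 1 - p - q = 1 - V - s vanishes
    exactly on the axis.  In the target, p = a is the height and
    q = (1 - a^2 - |y|^2) / (1 + a) ([half_depth]) vanishes on the round face;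
    the scaling of x is the one for which 1 - p - q = |y|^2 / (1 + a). *)
Definition ball_depth t N := (1 - t ^+ 2 - N) / 2.
Definition edge_radius t N := Num.sqrt (t ^+ 2 + ball_depth t N ^+ 2).
Definition fold_height t N := (ball_depth t N + t + edge_radius t N) / 2.
Definition fold_scale t N :=
  Num.sqrt (1 + fold_height t N) /
  Num.sqrt (1 - ball_depth t N + edge_radius t N).

(** The inverse of F: [unfold_weight] is the value of 1 - V + s in terms of p
    and q, using V = 2 p q / (p + q) and V + s = p + q. *)
Definition half_depth a N := (1 - a ^+ 2 - N) / (1 + a).
Definition unfold_height a N := a - half_depth a N.
Definition unfold_weight a N :=
  1 + (a + half_depth a N) - 4 * (a * half_depth a N / (a + half_depth a N)).
Definition unfold_scale a N := Num.sqrt (unfold_weight a N) / Num.sqrt (1 + a).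

(** The map P and, below, its inverse: a^2 = (rho - T) / 2 with
    rho = |(T, X)|, because T = |y|^2 - a^2 and rho = |y|^2 + a^2. *)
Definition parab_height a N := N - a ^+ 2.
Definition parab_scale a := 2 * a.

Definition eucl_radius T N := Num.sqrt (T ^+ 2 + N).
Definition unparab_height T N := Num.sqrt ((eucl_radius T N - T) / 2).

(** With q = (V - t + s) / 2 one has |y|^2 = (1 + a) (1 - a - q), so that
    a^2 + |y|^2 = 1 - (1 + a) q < 1, and [half_depth] recovers q. *)
Lemma fold_spec t N : 0 <= N -> t ^+ 2 + N < 1 ->
  [/\ 0 < ball_depth t N, 2^-1 <= 1 - ball_depth t N + edge_radius t N,
      0 < fold_height t N,
      fold_height t N ^+ 2 + fold_scale t N ^+ 2 * N < 1 &
      unfold_height (fold_height t N) (fold_scale t N ^+ 2 * N) = t /\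
      unfold_scale (fold_height t N) (fold_scale t N ^+ 2 * N) *
        fold_scale t N = 1].
Proof.
move=> N0 tN.
have V0 : 0 < ball_depth t N by rewrite /ball_depth; lra.
have VN : N = 1 - t ^+ 2 - 2 * ball_depth t N by rewrite /ball_depth; lra.
have V12 : ball_depth t N <= 2^-1 by rewrite /ball_depth; have := sqr_ge0 t;
  lra.
have s2 : edge_radius t N ^+ 2 = t ^+ 2 + ball_depth t N ^+ 2.
  by rewrite sqr_sqrtr// addr_ge0// sqr_ge0.
have s0 : 0 <= edge_radius t N by exact: sqrtr_ge0.
have st : `|t| < edge_radius t N.
  rewrite -[`|t|]sqrtr_sqr ltr_sqrt ?ltrDl ?exprn_gt0//.
  by rewrite ltr_wpDl ?sqr_ge0// exprn_gt0.
have /andP[st1 st2] : - edge_radius t N < t < edge_radius t N by rewrite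
  -ltr_norml.
have a0 : 0 < fold_height t N by rewrite /fold_height; lra.
have E12 : 2^-1 <= 1 - ball_depth t N + edge_radius t N by lra.
have E0 : 0 < 1 - ball_depth t N + edge_radius t N by lra.
have c2 : fold_scale t N ^+ 2 = (1 + fold_height t N) / (1 - ball_depth t N +
  edge_radius t N).
  by rewrite /fold_scale exprMn exprVn !sqr_sqrtr//; lra.
have N1 : fold_scale t N ^+ 2 * N = (1 + fold_height t N) * (1 - ball_depth t N
  - edge_radius t N).
  rewrite c2 [X in _ * X = _](_ : N = (1 - ball_depth t N - edge_radius t N) *
    (1 - ball_depth t N + edge_radius t N)).
    by field; rewrite gt_eqF.
  by rewrite -subr_sqr s2 {1}VN; ring.
rewrite N1.
have q0 : 0 < (ball_depth t N - t + edge_radius t N) / 2 by lra.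
have aq : fold_height t N = (ball_depth t N + t + edge_radius t N) / 2 by [].
have H1 : fold_height t N ^+ 2 + (1 + fold_height t N) * (1 - ball_depth t N -
  edge_radius t N) =
    1 - (1 + fold_height t N) * ((ball_depth t N - t + edge_radius t N) / 2).
  rewrite (_ : ball_depth t N - t + edge_radius t N =
    2 * (ball_depth t N + edge_radius t N - fold_height t N)); last
    by rewrite aq; field.
  by field.
have Hq : half_depth (fold_height t N) ((1 + fold_height t N) * (1 - ball_depth
  t N - edge_radius t N)) = (ball_depth t N - t + edge_radius t N) / 2.
  rewrite /half_depth -addrA -opprD H1; field.
  by rewrite gt_eqF//; lra.
split => //.
  by rewrite H1 ltrBlDr ltrDl mulr_gt0//; lra.
split => //.
  by rewrite /unfold_height Hq aq; lra.
have Hw : unfold_weight (fold_height t N) ((1 + fold_height t N) * (1 -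
  ball_depth t N - edge_radius t N)) = 1 - ball_depth t N + edge_radius t N.
  rewrite /unfold_weight Hq.
  have -> : fold_height t N + (ball_depth t N - t + edge_radius t N) / 2 =
    ball_depth t N + edge_radius t N by rewrite aq; field.
  have -> : fold_height t N * ((ball_depth t N - t + edge_radius t N) / 2) =
    ball_depth t N * (ball_depth t N + edge_radius t N) / 2.
    have -> : fold_height t N * ((ball_depth t N - t + edge_radius t N) / 2) =
      (ball_depth t N ^+ 2 + 2 * ball_depth t N * edge_radius t N + edge_radius
        t N ^+ 2 - t ^+ 2) / 4 by rewrite aq; field.
    by rewrite s2; field.
  by field; rewrite gt_eqF//; lra.
rewrite /unfold_scale Hw /fold_scale; field.
by rewrite !gt_eqF// sqrtr_gt0//; lra.
Qed.

(** Here |x|^2 = w (1 - a - q) with w the weight, and t = a - q, so that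
    t^2 + |x|^2 = 1 - 4 a q / (a + q) < 1; hence V = 2 a q / (a + q). *)
Lemma unfold_spec a N : 0 <= N -> 0 < a -> a ^+ 2 + N < 1 ->
  [/\ 0 < half_depth a N, 1 <= unfold_weight a N,
      unfold_height a N ^+ 2 + unfold_scale a N ^+ 2 * N < 1,
      fold_height (unfold_height a N) (unfold_scale a N ^+ 2 * N) = a &
      fold_scale (unfold_height a N) (unfold_scale a N ^+ 2 * N) *
        unfold_scale a N = 1].
Proof.
move=> N0 a0 aN.
have a1 : 0 < 1 + a by lra.
have q0 : 0 < half_depth a N by rewrite /half_depth divr_gt0//; lra.
have NE : N = (1 + a) * (1 - (a + half_depth a N)) by rewrite /half_depth;
  field; rewrite gt_eqF.
move: q0 NE; rewrite /unfold_scale /unfold_weight /unfold_height; set q :=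
  half_depth a N => q0 NE.
have D0 : 0 < a + q by lra.
set m := a * q / (a + q).
have m0 : 0 < m by rewrite divr_gt0// mulr_gt0.
have mD : a * q = m * (a + q) by rewrite /m; field; rewrite gt_eqF.
have w1 : 1 <= 1 + (a + q) - 4 * m.
  rewrite (_ : 1 + (a + q) - 4 * m = 1 + (a - q) ^+ 2 / (a + q)); last first.
    by rewrite /m; field; rewrite gt_eqF.
  by rewrite lerDl divr_ge0 ?sqr_ge0// ltW.
set w := 1 + (a + q) - 4 * m in w1 *.
have w0 : 0 < w by lra.
have c2 : (Num.sqrt w / Num.sqrt (1 + a)) ^+ 2 * N = w * (1 - (a + q)).
  rewrite exprMn exprVn !sqr_sqrtr ?(ltW w0) ?(ltW a1)// {1}NE; field.
  by rewrite gt_eqF.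
have tq : (a - q) ^+ 2 = (a + q) ^+ 2 - 4 * (m * (a + q)) by rewrite -mD; ring.
have sumE : (a - q) ^+ 2 + w * (1 - (a + q)) = 1 - 4 * m by rewrite tq /w; ring.
rewrite c2.
have VE : ball_depth (a - q) (w * (1 - (a + q))) = 2 * m.
  by rewrite /ball_depth -addrA -opprD sumE; field.
have Dm : 0 <= a + q - 2 * m.
  by move: w1; rewrite /w; lra.
have sE : edge_radius (a - q) (w * (1 - (a + q))) = a + q - 2 * m.
  rewrite /edge_radius VE -[RHS]ger0_norm// -sqrtr_sqr; congr Num.sqrt.
  by rewrite tq; ring.
have KaE : fold_height (a - q) (w * (1 - (a + q))) =
  a by rewrite /fold_height VE sE; field.
split => //.
  by rewrite sumE; lra.
rewrite /fold_scale KaE VE sE (_ : 1 - 2 * m + (a + q - 2 * m) = w); last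
  by rewrite /w; ring.
by field; rewrite !gt_eqF// sqrtr_gt0.
Qed.

Lemma parab_spec a N : 0 <= N -> 0 < a -> a ^+ 2 + N < 1 ->
  [/\ parab_height a N ^+ 2 + parab_scale a ^+ 2 * N < 1,
      unparab_height (parab_height a N) (parab_scale a ^+ 2 * N) = a &
      0 <= parab_height a N -> parab_scale a ^+ 2 * N != 0].
Proof.
move=> N0 a0 aN; rewrite /parab_height /parab_scale /unparab_height
  /eucl_radius.
have E : (N - a ^+ 2) ^+ 2 + (2 * a) ^+ 2 * N = (N + a ^+ 2) ^+ 2 by ring.
have a2 : 0 < a ^+ 2 by exact: exprn_gt0.
rewrite E sqrtr_sqr ger0_norm; last by lra.
split.
- by rewrite expr_lt1//; lra.
- rewrite (_ : (N + a ^+ 2 - (N - a ^+ 2)) / 2 = a ^+ 2); last by field.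
  by rewrite sqrtr_sqr gtr0_norm.
- move=> H; rewrite gt_eqF// mulr_gt0//; last by lra.
  by rewrite exprn_gt0// mulr_gt0.
Qed.

(** The last hypothesis says that the point is off the slit; it gives rho > T.
    Moreover |y|^2 = (rho + T) / 2, because N = (rho - T) (rho + T). *)
Lemma unparab_spec T N : 0 <= N -> T ^+ 2 + N < 1 -> (0 <= T -> N != 0) ->
  [/\ 0 < T ^+ 2 + N, 0 < eucl_radius T N - T, 0 < unparab_height T N,
      unparab_height T N ^+ 2 + (parab_scale (unparab_height T N))^-1 ^+ 2 * N
        < 1 &
      parab_height (unparab_height T N)
        ((parab_scale (unparab_height T N))^-1 ^+ 2 * N) = T].
Proof.
move=> N0 TN slit.
have r0 : 0 <= eucl_radius T N by exact: sqrtr_ge0.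
have rTN : 0 <= T ^+ 2 + N by rewrite addr_ge0// sqr_ge0.
have r2 : eucl_radius T N ^+ 2 = T ^+ 2 + N by rewrite sqr_sqrtr.
have r1 : eucl_radius T N < 1.
  by rewrite -(@expr_lt1 _ 2)// r2.
have rT : 0 < T ^+ 2 + N /\ 0 < eucl_radius T N - T.
  have [T0|T0] := leP 0 T.
    have N1 : 0 < N by rewrite lt_def slit.
    have H : 0 < T ^+ 2 + N by rewrite ltr_wpDl// sqr_ge0.
    split => //; rewrite subr_gt0 -[X in X < _]ger0_norm//
      -sqrtr_sqr ltr_sqrt//.
    by rewrite ltrDl.
  split; last by rewrite subr_gt0 (lt_le_trans T0).
  have T2 : 0 < T ^+ 2 by rewrite exprn_even_gt0 //= lt_eqF.
  by lra.
case: rT => TN0 rT0.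
have a0 : 0 < unparab_height T N by rewrite sqrtr_gt0; lra.
have a2 : unparab_height T N ^+ 2 = (eucl_radius T N - T) / 2 by rewrite
  sqr_sqrtr//; lra.
have N1 : (parab_scale (unparab_height T N))^-1 ^+ 2 * N =
  (eucl_radius T N + T) / 2.
  rewrite /parab_scale exprVn exprMn a2.
  rewrite [X in _ * X = _](_ : N = (eucl_radius T N - T) * (eucl_radius T N +
    T)); last first.
    by rewrite -subr_sqr r2; ring.
  by field; rewrite gt_eqF.
rewrite N1 /parab_height a2; split => //; lra.
Qed.

End scalars.

(** * Bounded Lipschitz and differentiable functions *)

Section bounded_lipschitz.
Context {R : realType} {V : normedModType R}.
Implicit Types (A : set V) (u w : V -> R).

(** Boundedness is included because products of Lipschitz functions need it. *)
Definition bdd_lipschitz A u := exists2 M, 0 <= M &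
  forall x y, A x -> A y -> `|u x| <= M /\ `|u x - u y| <= M * `|x - y|.

Lemma bdd_lipschitzI A u B L : (forall x, A x -> `|u x| <= B) ->
  (forall x y, A x -> A y -> `|u x - u y| <= L * `|x - y|) -> bdd_lipschitz A u.
Proof.
move=> HB HL; exists (`|B| + `|L|); first by rewrite addr_ge0.
move=> x y Ax Ay; split.
  by apply: le_trans (HB x Ax) _; rewrite ler_wpDr// ler_norm.
by apply: le_trans (HL x y Ax Ay) _; rewrite ler_wpM2r// ler_wpDl// ler_norm.
Qed.

Lemma bdd_lipschitz_cst A c : bdd_lipschitz A (fun=> c).
Proof.
apply: (@bdd_lipschitzI _ _ `|c| 0) => // x y _ _.
by rewrite subrr normr0 mul0r.
Qed.

Lemma eq_bdd_lipschitz A u w : (forall x, A x -> u x = w x) ->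
    bdd_lipschitz A u ->
  bdd_lipschitz A w.
Proof.
move=> E [M M0 MP]; exists M => // x y Ax Ay; rewrite -!E//; exact: MP.
Qed.

Lemma bdd_lipschitzD A u w : bdd_lipschitz A u -> bdd_lipschitz A w ->
  bdd_lipschitz A (fun x => u x + w x).
Proof.
move=> [M M0 MP] [N N0 NP].
apply: (@bdd_lipschitzI _ _ (M + N) (M + N)) => [x Ax|x y Ax Ay].
  rewrite (le_trans (ler_normD _ _))// lerD//; first by have [] := MP x x Ax Ax.
  by have [] := NP x x Ax Ax.
rewrite opprD addrACA (le_trans (ler_normD _ _))// mulrDl lerD//.
  by have [] := MP x y Ax Ay.
by have [] := NP x y Ax Ay.
Qed.

Lemma bdd_lipschitzM A u w : bdd_lipschitz A u -> bdd_lipschitz A w ->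
  bdd_lipschitz A (fun x => u x * w x).
Proof.
move=> [M M0 MP] [N N0 NP].
apply: (@bdd_lipschitzI _ _ (M * N) (M * N + M * N)) => [x Ax|x y Ax Ay].
  rewrite normrM ler_pM//; first by have [] := MP x x Ax Ax.
  by have [] := NP x x Ax Ax.
have [u1 u2] := MP x y Ax Ay; have [w1 w2] := NP x y Ax Ay.
have [w3 _] := NP y y Ay Ay.
rewrite (_ : _ - _ = u x * (w x - w y) + (u x - u y) * w y); last by ring.
rewrite (le_trans (ler_normD _ _))// [leRHS]mulrDl lerD// normrM.
  by rewrite -mulrA ler_pM.
by rewrite mulrAC ler_pM.
Qed.

Lemma bdd_lipschitzN A u : bdd_lipschitz A u ->
    bdd_lipschitz A (fun x => - u x).
Proof.
move=> Hu; apply: (eq_bdd_lipschitz _ (bdd_lipschitzM (bdd_lipschitz_cst A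
  (-1)) Hu)) => x _.
by rewrite mulN1r.
Qed.

Lemma bdd_lipschitz_sum A k (u : 'I_k -> V -> R) : (forall j,
    bdd_lipschitz A (u j)) ->
  bdd_lipschitz A (fun x => \sum_(j < k) u j x).
Proof.
move=> Hu; elim: k u Hu => [|k IH] u Hu.
  by apply: (eq_bdd_lipschitz _ (bdd_lipschitz_cst A 0)) => x _;
    rewrite big_ord0.
apply: (eq_bdd_lipschitz _ (bdd_lipschitzD (Hu ord0) (IH (fun j => u (lift ord0
  j)) _))) => [x _|j//].
by rewrite big_ord_recl.
Qed.

Lemma bdd_lipschitzV A u c : 0 < c -> (forall x, A x -> c <= u x) ->
    bdd_lipschitz A u ->
  bdd_lipschitz A (fun x => (u x)^-1).
Proof.
move=> c0 cu [M M0 MP].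
have u0 x : A x -> 0 < u x by move=> /cu; exact: lt_le_trans.
have ic0 : 0 <= c^-1 by rewrite invr_ge0 ltW.
have iu x : A x -> 0 <= (u x)^-1 <= c^-1.
  by move=> Ax; rewrite invr_ge0 ltW ?u0//= lef_pV2 ?posrE ?u0// cu.
apply: (@bdd_lipschitzI _ _ c^-1 (c^-1 * c^-1 * M)) => [x Ax|x y Ax Ay].
  by have /andP[H1 H2] := iu x Ax; rewrite ger0_norm.
rewrite (_ : (u x)^-1 - (u y)^-1 = (u x)^-1 * (u y)^-1 * (u y - u x)); last
  first.
  by field; rewrite !gt_eqF ?u0.
have /andP[x1 x2] := iu x Ax; have /andP[y1 y2] := iu y Ay.
have [_ H] := MP x y Ax Ay.
rewrite normrM -[leRHS]mulrA; apply: ler_pM => //; last by rewrite distrC.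
by rewrite ger0_norm; [exact: ler_pM|exact: mulr_ge0].
Qed.

Lemma bdd_lipschitz_sqrt A u c : 0 < c -> (forall x, A x -> c <= u x) ->
    bdd_lipschitz A u ->
  bdd_lipschitz A (fun x => Num.sqrt (u x)).
Proof.
move=> c0 cu [M M0 MP].
apply: (@bdd_lipschitzI _ _ (Num.sqrt M) ((Num.sqrt c)^-1 * M)) => [x Ax|x y Ax
  Ay].
  rewrite ger0_norm ?sqrtr_ge0// ler_wsqrtr//.
  by have [H _] := MP x x Ax Ax; apply: le_trans H; exact: ler_norm.
apply: le_trans (ler_dist_sqrt c0 (cu x Ax) (cu y Ay)) _.
rewrite -mulrA ler_wpM2l ?invr_ge0 ?sqrtr_ge0//.
by have [] := MP x y Ax Ay.
Qed.

Lemma bdd_lipschitz_hypot A u w : bdd_lipschitz A u -> bdd_lipschitz A w ->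
  bdd_lipschitz A (fun x => Num.sqrt (u x ^+ 2 + w x ^+ 2)).
Proof.
move=> [M M0 MP] [N N0 NP].
apply: (@bdd_lipschitzI _ _ (M + N) (M + N)) => [x Ax|x y Ax Ay].
  have [u1 _] := MP x x Ax Ax; have [w1 _] := NP x x Ax Ax.
  have := ler_dist_hypot (u x) (w x) 0 0.
  rewrite expr0n addr0 sqrtr0 !subr0 => H; apply: le_trans H _; exact: lerD.
have [_ u1] := MP x y Ax Ay; have [_ w1] := NP x y Ax Ay.
by apply: le_trans (ler_dist_hypot _ _ _ _) _; rewrite mulrDl lerD.
Qed.

Lemma bdd_lipschitz_harmonic A u w : (forall x, A x -> 0 < u x) -> (forall x,
    A x -> 0 < w x) ->
  bdd_lipschitz A u -> bdd_lipschitz A w ->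
  bdd_lipschitz A (fun x => u x * w x / (u x + w x)).
Proof.
move=> u0 w0 [M M0 MP] [N N0 NP].
apply: (@bdd_lipschitzI _ _ M (M + N)) => [x Ax|x y Ax Ay].
  have [u1 _] := MP x x Ax Ax.
  have uw : 0 < u x + w x by rewrite addr_gt0 ?u0 ?w0.
  rewrite -mulrA normrM (le_trans _ u1)// ler_piMr// ger0_norm; last first.
    by apply: divr_ge0; apply: ltW => //; exact: w0.
  by rewrite ler_pdivrMr// mul1r lerDr ltW ?u0.
have [_ u1] := MP x y Ax Ay; have [_ w1] := NP x y Ax Ay.
apply: le_trans (ler_dist_harmonic _ _ _ _) _;
  [exact: u0|exact: w0|exact: u0|exact: w0|].
by rewrite mulrDl lerD.
Qed.

(** The differentiation rules on lambda-abstractions, the form in which they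
    unify with explicit formulas. *)
Lemma differentiable_funD u w x : differentiable u x -> differentiable w x ->
  differentiable (fun y => u y + w y : R) x.
Proof. by move=> du dw; exact: differentiableD. Qed.

Lemma differentiable_funN u x : differentiable u x ->
    differentiable (fun y => - u y : R) x.
Proof. by move=> du; exact: differentiableN. Qed.

Lemma differentiable_funM u w x : differentiable u x -> differentiable w x ->
  differentiable (fun y => u y * w y : R) x.
Proof. by move=> du dw; exact: differentiableM. Qed.

Lemma differentiable_funV u x : u x != 0 -> differentiable u x ->
  differentiable (fun y => (u y)^-1 : R) x.
Proof. by move=> ux du; exact: differentiableV. Qed.

Lemma differentiable_fun_cst (c : R) x : differentiable (fun _ : V => c) x.
Proof. exact: differentiable_cst. Qed.

Lemma differentiable_fun_sqrt u x : 0 < u x -> differentiable u x ->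
  differentiable (fun y => Num.sqrt (u y) : R) x.
Proof.
move=> ux du; apply: (@differentiable_comp R V R R u (@Num.sqrt R)) => //.
by apply/derivable1_diffP; have [] := @is_derive1_sqrt R (u x) ux.
Qed.

Lemma differentiable_fun_sum k (u : 'I_k -> V -> R) x : (forall j,
    differentiable (u j) x) ->
  differentiable (fun y => \sum_(j < k) u j y : R) x.
Proof.
move=> du; rewrite (_ : (fun y => _) = \sum_(j < k) u j).
  exact: differentiable_sum.
by apply/funext => y; rewrite fct_sumE.
Qed.

End bounded_lipschitz.

(** * The maps between the ball, the half-ball and the slit ball *)

Section maps.
Context {R : realType} {m : nat}.
Local Notation Rn := 'rV[R]_m.+1.
Implicit Types (z : Rn) (a c : R) (A : set Rn) (F : Rn -> Rn).

Definition radial_sqr z : R := \sum_(j < m) z 0 (lift ord0 j) ^+ 2.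

Definition axial a c z : Rn := \row_i (if i == ord0 then a else c * z 0 i).

Lemma axial0 a c z : axial a c z 0 0 = a.
Proof. by rewrite mxE eqxx. Qed.

Lemma axialS a c z j : axial a c z 0 (lift ord0 j) = c * z 0 (lift ord0 j).
Proof. by rewrite mxE eq_sym (negbTE (neq_lift _ _)). Qed.

Lemma radial_sqr_axial a c z : radial_sqr (axial a c z) = c ^+ 2 * radial_sqr z.
Proof.
by rewrite /radial_sqr mulr_sumr; apply: eq_bigr => j _; rewrite axialS exprMn.
Qed.

Lemma radial_sqr_ge0 z : 0 <= radial_sqr z.
Proof. by apply: sumr_ge0 => j _; exact: sqr_ge0. Qed.

Lemma axial_axial a c a' c' z : axial a c (axial a' c' z) = axial a (c * c') z.
Proof.
by apply/rowP => i; rewrite !mxE; case: ifP => // ->; rewrite mulrA.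
Qed.

Lemma axial_id z : axial (z 0 0) 1 z = z.
Proof.
by apply/rowP => i; rewrite mxE; case: ifP => [/eqP ->|_]; rewrite ?mul1r.
Qed.

Lemma sum_sqr z : \sum_i z 0 i ^+ 2 = z 0 0 ^+ 2 + radial_sqr z.
Proof. by rewrite big_ord_recl. Qed.

Lemma unit_ballE z : unit_ball z <-> z 0 0 ^+ 2 + radial_sqr z < 1.
Proof.
rewrite /unit_ball /= /enorm sum_sqr -[X in _ < X]sqrtr1 ltr_sqrt; first by [].
exact: ltr01.
Qed.

Lemma slitE z : unit_ball z -> slit z <-> 0 <= z 0 0 /\ radial_sqr z = 0.
Proof.
move=> /unit_ballE zB; split.
  move=> H; split; first by have := H ord0; rewrite /= => /andP[].
  apply: big1 => j _; have := H (lift ord0 j); rewrite /= => /eqP ->.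
  by rewrite expr0n.
move=> [z0 r0] i; have [j ->|->] := unliftP ord0 i => /=.
  move: r0 => /eqP; rewrite psumr_eq0; last by move=> k _; exact: sqr_ge0.
  by move=> /allP /(_ j (mem_index_enum j)) /=; rewrite sqrf_eq0.
by rewrite z0 /= -(@expr_lt1 _ 2)//; move: zB; rewrite r0 addr0.
Qed.

Definition slit_ball : set Rn := unit_ball `\` slit.

Definition half_ball : set Rn := [set z : Rn | 0 < z 0 0 /\ unit_ball z].

Lemma slit_ballE z : slit_ball z <->
  z 0 0 ^+ 2 + radial_sqr z < 1 /\ (0 <= z 0 0 -> radial_sqr z != 0).
Proof.
split.
  move=> [zB zs]; split; first exact/unit_ballE.
  by move=> z0; apply/eqP => r0; apply: zs; apply/slitE.
move=> [/unit_ballE zB H]; split=> // /(slitE zB) [z0 /eqP r0].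
by move: (H z0); rewrite r0.
Qed.

Definition fold_map z :=
  axial (fold_height (z 0 0) (radial_sqr z))
    (fold_scale (z 0 0) (radial_sqr z)) z.

Definition unfold_map z :=
  axial (unfold_height (z 0 0) (radial_sqr z))
    (unfold_scale (z 0 0) (radial_sqr z)) z.

Definition parab_map z :=
  axial (parab_height (z 0 0) (radial_sqr z)) (parab_scale (z 0 0)) z.

Definition unparab_map z :=
  axial (unparab_height (z 0 0) (radial_sqr z))
    (parab_scale (unparab_height (z 0 0) (radial_sqr z)))^-1 z.

Lemma fold_half_ball z : unit_ball z -> half_ball (fold_map z).
Proof.
move=> /unit_ballE zB; have [_ _ a0 H _] := fold_spec (radial_sqr_ge0 z) zB.
split; first by rewrite axial0.
by apply/unit_ballE; rewrite axial0 radial_sqr_axial.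
Qed.

Lemma fold_mapK z : unit_ball z -> unfold_map (fold_map z) = z.
Proof.
move=> /unit_ballE zB; have [_ _ a0 H [Ht Hc]] :=
  fold_spec (radial_sqr_ge0 z) zB.
by rewrite /unfold_map axial0 radial_sqr_axial axial_axial Ht Hc axial_id.
Qed.

Lemma unfold_ball z : half_ball z -> unit_ball (unfold_map z).
Proof.
move=> [z0 /unit_ballE zB]; have [_ _ H _ _] :=
  unfold_spec (radial_sqr_ge0 z) z0 zB.
by apply/unit_ballE; rewrite axial0 radial_sqr_axial.
Qed.

Lemma unfold_mapK z : half_ball z -> fold_map (unfold_map z) = z.
Proof.
move=> [z0 /unit_ballE zB]; have [_ _ _ Ha Hc] :=
  unfold_spec (radial_sqr_ge0 z) z0 zB.
by rewrite /fold_map axial0 radial_sqr_axial axial_axial Ha Hc axial_id.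
Qed.

Lemma parab_slit_ball z : half_ball z -> slit_ball (parab_map z).
Proof.
move=> [z0 /unit_ballE zB]; have [H _ Hs] := parab_spec (radial_sqr_ge0 z) z0
  zB.
by apply/slit_ballE; rewrite axial0 radial_sqr_axial.
Qed.

Lemma parab_mapK z : half_ball z -> unparab_map (parab_map z) = z.
Proof.
move=> [z0 /unit_ballE zB]; have [_ Ha _] := parab_spec (radial_sqr_ge0 z) z0
  zB.
rewrite /unparab_map axial0 radial_sqr_axial axial_axial Ha mulVf ?axial_id//.
by rewrite gt_eqF// mulr_gt0.
Qed.

Lemma unparab_half_ball z : slit_ball z -> half_ball (unparab_map z).
Proof.
move=> /slit_ballE [zB zs]; have [_ _ a0 H _] :=
  unparab_spec (radial_sqr_ge0 z) zB zs.
split; first by rewrite axial0.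
by apply/unit_ballE; rewrite axial0 radial_sqr_axial.
Qed.

Lemma unparab_mapK z : slit_ball z -> parab_map (unparab_map z) = z.
Proof.
move=> /slit_ballE [zB zs]; have [_ _ a0 _ H] :=
  unparab_spec (radial_sqr_ge0 z) zB zs.
rewrite /parab_map axial0 radial_sqr_axial axial_axial H mulfV ?axial_id//.
by rewrite gt_eqF// mulr_gt0.
Qed.

Lemma ball_coord z i : unit_ball z -> `|z 0 i| <= 1.
Proof.
move=> /unit_ballE zB; have : z 0 i ^+ 2 <= 1.
  rewrite -sum_sqr in zB; apply: le_trans (ltW zB).
  by rewrite (bigD1 i)//= lerDl sumr_ge0// => j _; exact: sqr_ge0.
by rewrite -[z 0 i ^+ 2]real_normK ?num_real// expr_le1.
Qed.

Lemma bdd_lipschitz_coord A i : A `<=` unit_ball ->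
    bdd_lipschitz A (fun z => z 0 i).
Proof.
move=> AB; apply: (@bdd_lipschitzI _ _ _ _ 1 1) => [x /AB|x y _ _].
  exact: ball_coord.
by have := normr_coord (x - y) i; rewrite !mxE mul1r.
Qed.

Definition bdd_lipschitz_map A F := forall i, bdd_lipschitz A (fun z => F z 0
    i).

Lemma bdd_lipschitz_sqr A (u : Rn -> R) : bdd_lipschitz A u ->
    bdd_lipschitz A (fun z => u z ^+ 2).
Proof. by move=> Hu; apply: (eq_bdd_lipschitz _ (bdd_lipschitzM Hu Hu)) => z _;
  rewrite expr2. Qed.

Lemma bdd_lipschitz_radial_sqr A F : bdd_lipschitz_map A F ->
    bdd_lipschitz A (fun z => radial_sqr (F z)).
Proof. by move=> HF; apply: bdd_lipschitz_sum => j; apply: bdd_lipschitz_sqr;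
  exact: HF. Qed.

Lemma bdd_lipschitz_axial A F (a c : Rn -> R) : bdd_lipschitz A a ->
    bdd_lipschitz A c ->
  bdd_lipschitz_map A F -> bdd_lipschitz_map A (fun z => axial (a z) (c z) (F
    z)).
Proof.
move=> Ha Hc HF i; case: (altP (i =P ord0)) => [->|i0].
  by apply: (eq_bdd_lipschitz _ Ha) => z _; rewrite axial0.
by apply: (eq_bdd_lipschitz _ (bdd_lipschitzM Hc (HF i))) => z _;
  rewrite mxE (negbTE i0).
Qed.

Lemma bdd_lipschitzB A (u w : Rn -> R) : bdd_lipschitz A u ->
    bdd_lipschitz A w ->
  bdd_lipschitz A (fun z => u z - w z).
Proof. by move=> Hu Hw; apply: bdd_lipschitzD => //; exact: bdd_lipschitzN. Qed.

Lemma bdd_lipschitz_fold : bdd_lipschitz_map unit_ball fold_map.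
Proof.
have Hid : bdd_lipschitz_map unit_ball (id : Rn -> Rn) by move=> i;
  exact: bdd_lipschitz_coord.
have H0 := Hid 0; have Hr := bdd_lipschitz_radial_sqr Hid.
have HV : bdd_lipschitz unit_ball (fun z => ball_depth (z 0 0) (radial_sqr z)).
  by apply: bdd_lipschitzM; [apply: bdd_lipschitzB => //;
    apply: bdd_lipschitzB; [exact: bdd_lipschitz_cst|exact:
    bdd_lipschitz_sqr]|exact: bdd_lipschitz_cst].
have Hs : bdd_lipschitz unit_ball (fun z => edge_radius (z 0 0) (radial_sqr z))
  by exact: bdd_lipschitz_hypot.
have Ha : bdd_lipschitz unit_ball (fun z => fold_height (z 0 0) (radial_sqr z)).
  by apply: bdd_lipschitzM; [apply: bdd_lipschitzD => //;
    exact: bdd_lipschitzD|exact: bdd_lipschitz_cst].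
apply: bdd_lipschitz_axial => //; apply: bdd_lipschitzM.
  apply: (@bdd_lipschitz_sqrt _ _ _ _ 1) => //; last
    by apply: bdd_lipschitzD => //; exact: bdd_lipschitz_cst.
  move=> z /unit_ballE zB; have [_ _ a0 _ _] := fold_spec (radial_sqr_ge0 z) zB.
  by rewrite lerDl ltW.
apply: (@bdd_lipschitzV _ _ _ _ (Num.sqrt 2^-1));
  first by rewrite sqrtr_gt0 invr_gt0.
  move=> z /unit_ballE zB; have [_ e0 _ _ _] := fold_spec (radial_sqr_ge0 z) zB.
  exact: ler_wsqrtr.
apply: (@bdd_lipschitz_sqrt _ _ _ _ 2^-1); first by rewrite invr_gt0.
  by move=> z /unit_ballE zB; have [_ e0 _ _ _] :=
    fold_spec (radial_sqr_ge0 z) zB.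
by apply: bdd_lipschitzD => //; apply: bdd_lipschitzB => //;
  exact: bdd_lipschitz_cst.
Qed.

Lemma bdd_lipschitz_parab A F : bdd_lipschitz_map A F ->
    bdd_lipschitz_map A (parab_map \o F).
Proof.
move=> HF; apply: bdd_lipschitz_axial => //.
  by apply: bdd_lipschitzB; [exact:
    bdd_lipschitz_radial_sqr|exact/bdd_lipschitz_sqr].
by apply: bdd_lipschitzM => //; exact: bdd_lipschitz_cst.
Qed.

Lemma bdd_lipschitz_unfold : bdd_lipschitz_map half_ball unfold_map.
Proof.
have Hid : bdd_lipschitz_map half_ball (id : Rn -> Rn).
  by move=> i; apply: bdd_lipschitz_coord => z [].
have H0 := Hid 0; have Hr := bdd_lipschitz_radial_sqr Hid.
have H1 : bdd_lipschitz half_ball (fun z => 1 + z 0 0).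
  by apply: bdd_lipschitzD => //; exact: bdd_lipschitz_cst.
have Hq : bdd_lipschitz half_ball (fun z => half_depth (z 0 0) (radial_sqr z)).
  apply: bdd_lipschitzM.
    by apply: bdd_lipschitzB => //; apply: bdd_lipschitzB;
      [exact: bdd_lipschitz_cst|exact: bdd_lipschitz_sqr].
  by apply: (@bdd_lipschitzV _ _ _ _ 1) => // z [z0 _]; rewrite lerDl ltW.
have Hw : bdd_lipschitz half_ball (fun z => unfold_weight (z 0 0) (radial_sqr
  z)).
  apply: bdd_lipschitzB.
    by apply: bdd_lipschitzD; [exact: bdd_lipschitz_cst|exact: bdd_lipschitzD].
  apply: bdd_lipschitzM; first exact: bdd_lipschitz_cst.
  apply: bdd_lipschitz_harmonic => //; first by move=> z [].
  by move=> z [z0 /unit_ballE zB]; have [] := unfold_spec (radial_sqr_ge0 z) z0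
    zB.
apply: bdd_lipschitz_axial => //; first exact: bdd_lipschitzB.
apply: bdd_lipschitzM.
  apply: (@bdd_lipschitz_sqrt _ _ _ _ 1) => //.
  by move=> z [z0 /unit_ballE zB]; have [] := unfold_spec (radial_sqr_ge0 z) z0
    zB.
apply: (@bdd_lipschitzV _ _ _ _ 1) => //.
  by move=> z [z0 _]; rewrite -[leLHS]sqrtr1 ler_wsqrtr// lerDl ltW.
by apply: (@bdd_lipschitz_sqrt _ _ _ _ 1) => // z [z0 _]; rewrite lerDl ltW.
Qed.

(** With S = a + a', al = a - a', and s, d the sum and the difference of the
    y-parts, the components of the difference of the images are <s, d> - S al
    and S d + al s.  The mixed terms of the squares cancel, leaving
    S^2 (al^2 + |d|^2) + <s, d>^2 + al^2 |s|^2. *)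
Lemma parab_map_expanding z (w : Rn) :
  (z 0 0 + w 0 0) ^+ 2 * \sum_i (z 0 i - w 0 i) ^+ 2 <=
  \sum_i (parab_map z 0 i - parab_map w 0 i) ^+ 2.
Proof.
rewrite !big_ord_recl /= !axial0 /parab_height /parab_scale.
under [X in _ <= _ + X]eq_bigr do rewrite !axialS.
set al := z 0 0 - w 0 0; set S := z 0 0 + w 0 0.
pose d j := z 0 (lift ord0 j) - w 0 (lift ord0 j).
pose s j := z 0 (lift ord0 j) + w 0 (lift ord0 j).
have E1 : radial_sqr z - z 0 0 ^+ 2 - (radial_sqr w - w 0 0 ^+ 2) =
    \sum_j s j * d j - S * al.
  have -> : \sum_j s j * d j = radial_sqr z - radial_sqr w.
    by rewrite /radial_sqr -sumrB; apply: eq_bigr => j _; rewrite /s /d; ring.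
  by rewrite /S /al; ring.
rewrite E1.
under [X in _ <= _ + X]eq_bigr => j _.
  rewrite (_ : 2 * z 0 0 * z 0 (lift ord0 j) - 2 * w 0 0 * w 0 (lift ord0 j) =
    S * d j + al * s j); last by move=> *; rewrite /S /al /s /d; ring.
  rewrite (_ : _ ^+ 2 = S ^+ 2 * d j ^+ 2 + (2 * S * al) * (s j * d j) + al ^+
    2 * s j ^+ 2); last by ring.
  over.
rewrite 2!big_split /= -!mulr_sumr.
set P := \sum_j s j * d j.
rewrite (_ : (P - S * al) ^+ 2 + _ = S ^+ 2 * (al ^+ 2 + \sum_j d j ^+ 2)
   + (P ^+ 2 + al ^+ 2 * \sum_j s j ^+ 2)); last by ring.
by rewrite lerDl addr_ge0 ?sqr_ge0// mulr_ge0 ?sqr_ge0// sumr_ge0// => j _;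
  exact: sqr_ge0.
Qed.

End maps.

Section regularity.
Context {R : realType} {m : nat}.
Local Notation Rn := 'rV[R]_m.+1.
Implicit Types (z : Rn) (a c : R) (A : set Rn) (F : Rn -> Rn).

(** Only the height over z is kept from [parab_map_expanding], so that the
    bound is a Lipschitz constant at z against every w. *)
Lemma unparab_map_dist z (w : Rn) i : slit_ball z -> slit_ball w ->
  unparab_map z 0 0 * `|unparab_map z 0 i - unparab_map w 0 i| <=
    m.+1%:R * `|z - w|.
Proof.
move=> zS wS; have := parab_map_expanding (unparab_map z) (unparab_map w).
rewrite !unparab_mapK//.
have [z0 _] := unparab_half_ball zS; have [w0 _] := unparab_half_ball wS.
set x := unparab_map z in z0 *; set y := unparab_map w in w0 *.
move=> H.
have H1 : ((x 0 0 + y 0 0) * `|x 0 i - y 0 i|) ^+ 2 <=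
  (m.+1%:R * `|z - w|) ^+ 2.
  rewrite exprMn real_normK ?num_real//.
  apply: (@le_trans _ _ (\sum_i (z 0 i - w 0 i) ^+ 2)).
    apply: le_trans H; rewrite ler_wpM2l ?sqr_ge0//.
    by rewrite (bigD1 i)//= lerDl sumr_ge0// => j _; exact: sqr_ge0.
  apply: (@le_trans _ _ (\sum_(i < m.+1) `|z - w| ^+ 2)).
    apply: ler_sum => j _; rewrite -[leLHS]real_normK ?num_real//.
    rewrite ler_pXn2r ?nnegrE//.
    by have := normr_coord (z - w) j; rewrite !mxE.
  rewrite sumr_const card_ord -[leLHS]mulr_natl exprMn ler_wpM2r ?sqr_ge0//.
  by rewrite expr2 ler_peMl// ler1n.
have H2 : (x 0 0 + y 0 0) * `|x 0 i - y 0 i| <= m.+1%:R * `|z - w|.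
  by move: H1; rewrite ler_pXn2r// nnegrE mulr_ge0// addr_ge0// ltW.
by apply: le_trans H2; rewrite ler_wpM2r// lerDl ltW.
Qed.

Lemma bdd_lipschitz_map_uniform A F : bdd_lipschitz_map A F ->
  exists2 M, 0 <= M & forall i x y, A x -> A y -> `|F x 0 i - F y 0 i| <=
    M * `|x - y|.
Proof.
move=> HF; have /choice [M MP] : forall i, exists M, 0 <= M /\
    forall x y, A x -> A y -> `|F x 0 i - F y 0 i| <= M * `|x - y|.
  by move=> i; have [M M0 MP] := HF i; exists M; split=> // x y Ax Ay;
    have [] := MP x y Ax Ay.
exists (\sum_i M i); first by apply: sumr_ge0 => i _; have [] := MP i.
move=> i x y Ax Ay; have [_ H] := MP i; apply: le_trans (H x y Ax Ay) _.
rewrite ler_wpM2r// (bigD1 i)//= lerDl sumr_ge0// => j _.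
by have [] := MP j.
Qed.

Lemma unfold_unparab_lipschitz : exists2 C, 0 <= C & forall i z (w : Rn),
  slit_ball z -> slit_ball w ->
  `|unfold_map (unparab_map z) 0 i - unfold_map (unparab_map w) 0 i| <=
    C / unparab_map z 0 0 * `|z - w|.
Proof.
have [M M0 MP] := bdd_lipschitz_map_uniform (@bdd_lipschitz_unfold R m).
exists (M * m.+1%:R); first by rewrite mulr_ge0.
move=> i z w zS wS.
have [z0 _] := unparab_half_ball zS.
apply: le_trans (MP i _ _ (unparab_half_ball zS) (unparab_half_ball wS)) _.
rewrite -!mulrA ler_wpM2l//; apply: rV_norm_le.
  by rewrite mulr_ge0// mulr_ge0// invr_ge0 ltW.
move=> j.
have -> : (unparab_map z - unparab_map w) 0 j =
  unparab_map z 0 j - unparab_map w 0 j.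
  by rewrite [LHS]mxE [X in _ + X]mxE.
rewrite mulrCA ler_pdivlMl//.
exact: unparab_map_dist.
Qed.

Definition coord_differentiable F z :=
  forall i, differentiable (fun y => F y 0 i) z.

Lemma coord_differentiable_id z : coord_differentiable id z.
Proof. by move=> i; exact: differentiable_coord. Qed.

Lemma differentiable_fun_sqr (u : Rn -> R) z : differentiable u z ->
    differentiable (fun y => u y ^+ 2) z.
Proof.
move=> du; rewrite (_ : (fun y => _) = (fun y => u y * u y));
  first exact: differentiable_funM.
by apply/funext => y; rewrite expr2.
Qed.

Lemma differentiable_funB (u w : Rn -> R) z : differentiable u z ->
    differentiable w z ->
  differentiable (fun y => u y - w y) z.
Proof. by move=> du dw; apply: differentiable_funD => //;
  exact: differentiable_funN. Qed.

Lemma differentiable_radial_sqr F z : coord_differentiable F z ->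
    differentiable (fun y => radial_sqr (F y)) z.
Proof. by move=> dF; apply: differentiable_fun_sum => j;
  exact: differentiable_fun_sqr. Qed.

Lemma coord_differentiable_axial F (a c : Rn -> R) z : differentiable a z ->
    differentiable c z ->
  coord_differentiable F z ->
  coord_differentiable (fun y => axial (a y) (c y) (F y)) z.
Proof.
move=> da dc dF i.
rewrite (_ : (fun y => _) = if i == ord0 then a else fun y => c y * F y 0 i).
  by case: ifP => // _; exact: differentiable_funM.
by apply/funext => y; rewrite mxE; case: ifP.
Qed.

Lemma coord_differentiable_fold z : unit_ball z ->
    coord_differentiable fold_map z.
Proof.
move=> /unit_ballE zB; have [V0 e0 a0 _ _] := fold_spec (radial_sqr_ge0 z) zB.
have Hid := coord_differentiable_id z; have H0 := Hid 0; have Hr :=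
  differentiable_radial_sqr Hid.
have HV : differentiable (fun z : Rn => ball_depth (z 0 0) (radial_sqr z)) z.
  by apply: differentiable_funM; [apply: differentiable_funB => //;
    apply: differentiable_funB; [exact: differentiable_fun_cst|exact:
    differentiable_fun_sqr]|exact: differentiable_fun_cst].
have Hs : differentiable (fun z : Rn => edge_radius (z 0 0) (radial_sqr z)) z.
  apply: differentiable_fun_sqrt; last by apply: differentiable_funD;
    exact: differentiable_fun_sqr.
  by rewrite ltr_wpDl ?sqr_ge0// exprn_gt0.
have Ha : differentiable (fun z : Rn => fold_height (z 0 0) (radial_sqr z)) z.
  by apply: differentiable_funM; [apply: differentiable_funD => //;
    exact: differentiable_funD|exact: differentiable_fun_cst].
have h20 : 0 < 2^-1 :> R by rewrite invr_gt0.
have e1 := lt_le_trans h20 e0.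
apply: coord_differentiable_axial => //; apply: differentiable_funM.
  apply: differentiable_fun_sqrt; first by rewrite addr_gt0.
  by apply: differentiable_funD => //; exact: differentiable_fun_cst.
apply: differentiable_funV; first by rewrite gt_eqF// sqrtr_gt0.
apply: differentiable_fun_sqrt => //.
by apply: differentiable_funD => //; apply: differentiable_funB => //;
  exact: differentiable_fun_cst.
Qed.

Lemma coord_differentiable_parab F z : coord_differentiable F z ->
    coord_differentiable (parab_map \o F) z.
Proof.
move=> dF; apply: coord_differentiable_axial => //.
  by apply: differentiable_funB; [exact: differentiable_radial_sqr|exact:
    differentiable_fun_sqr].
by apply: differentiable_funM => //; exact: differentiable_fun_cst.
Qed.

Lemma differentiable_unparab_height z : slit_ball z ->
  differentiable (fun z : Rn => unparab_height (z 0 0) (radial_sqr z)) z.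
Proof.
move=> /slit_ballE [zB zs]; have [r0 rz a0 _ _] :=
  unparab_spec (radial_sqr_ge0 z) zB zs.
have Hid := coord_differentiable_id z; have H0 := Hid 0; have Hr :=
  differentiable_radial_sqr Hid.
apply: differentiable_fun_sqrt; first by rewrite divr_gt0.
apply: differentiable_funM; last exact: differentiable_fun_cst.
by apply: differentiable_funB => //; apply: differentiable_fun_sqrt => //;
  apply: differentiable_funD => //; exact: differentiable_fun_sqr.
Qed.

Lemma coord_differentiable_unparab z : slit_ball z ->
    coord_differentiable unparab_map z.
Proof.
move=> zS; have Ha := differentiable_unparab_height zS; move: zS.
move=> /slit_ballE [zB zs]; have [r0 rz a0 _ _] :=
  unparab_spec (radial_sqr_ge0 z) zB zs.
have Hid := coord_differentiable_id z.
apply: coord_differentiable_axial => //; apply: differentiable_funV;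
  first by rewrite gt_eqF// mulr_gt0.
by apply: differentiable_funM => //; exact: differentiable_fun_cst.
Qed.

Lemma coord_differentiable_unfold F z : half_ball (F z) ->
    coord_differentiable F z ->
  coord_differentiable (unfold_map \o F) z.
Proof.
move=> [a0 /unit_ballE zB] dF.
have [q0 w1 _ _ _] := unfold_spec (radial_sqr_ge0 (F z)) a0 zB.
have H0 := dF 0; have Hr := differentiable_radial_sqr dF.
have a1 : 0 < 1 + F z 0 0 by rewrite addr_gt0.
have H1 : differentiable (fun z => 1 + F z 0 0) z by apply: differentiable_funD
  => //; exact: differentiable_fun_cst.
have Hq : differentiable (fun z => half_depth (F z 0 0) (radial_sqr (F z))) z.
  apply: differentiable_funM; last by apply: differentiable_funV => //;
    rewrite gt_eqF.
  by apply: differentiable_funB => //; apply: differentiable_funB;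
    [exact: differentiable_fun_cst|exact: differentiable_fun_sqr].
have Haq : differentiable (fun z => F z 0 0 + half_depth (F z 0 0) (radial_sqr
  (F z))) z by exact: differentiable_funD.
have Hw : differentiable (fun z => unfold_weight (F z 0 0) (radial_sqr (F z)))
  z.
  apply: differentiable_funB; first by apply: differentiable_funD => //;
    exact: differentiable_fun_cst.
  apply: differentiable_funM; first exact: differentiable_fun_cst.
  apply: differentiable_funM; first exact: differentiable_funM.
  by apply: differentiable_funV => //; rewrite gt_eqF// addr_gt0.
apply: coord_differentiable_axial => //; first exact: differentiable_funB.
apply: differentiable_funM; first by apply: differentiable_fun_sqrt => //;
  exact: lt_le_trans w1.
apply: differentiable_funV; first by rewrite gt_eqF// sqrtr_gt0.
exact: differentiable_fun_sqrt.
Qed.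

Lemma open_lt_fun (u w : Rn -> R) : (forall z, differentiable u z) ->
  (forall z, differentiable w z) -> open [set z | u z < w z].
Proof.
move=> du dw.
have c : continuous (fun z => w z - u z).
  by move=> z; apply: differentiable_continuous; exact: differentiable_funB.
rewrite (_ : [set z | _] = (fun z => w z - u z) @^-1` [set x | 0 < x]); last
  first.
  by apply/seteqP; split => z /=; rewrite subr_gt0.
by apply: open_comp; [move=> z _; exact: c|exact: open_gt].
Qed.

Lemma open_unit_ball : open (unit_ball : set Rn).
Proof.
rewrite (_ : unit_ball = [set z : Rn | z 0 0 ^+ 2 + radial_sqr z < 1]); last
  first.
  by apply/seteqP; split => z /unit_ballE.
apply: open_lt_fun => z; last exact: differentiable_fun_cst.
by apply: differentiable_funD; [apply: differentiable_fun_sqr;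
  exact: coord_differentiable_id|
  exact/differentiable_radial_sqr/coord_differentiable_id].
Qed.

Lemma open_slit_ball : open (slit_ball : set Rn).
Proof.
rewrite (_ : slit_ball = (unit_ball : set Rn) `&` ([set z : Rn | z 0 0 < 0] `|`
  [set z : Rn | 0 < radial_sqr z])).
  apply: openI; first exact: open_unit_ball.
  apply: openU.
    by apply: open_lt_fun => z; [exact: coord_differentiable_id|exact:
      differentiable_fun_cst].
  by apply: open_lt_fun => z; [exact:
    differentiable_fun_cst|exact/differentiable_radial_sqr/coord_differentiable_id].
apply/seteqP; split => z.
  move=> /slit_ballE [zB zs]; split; first exact/unit_ballE.
  have [z0|z0] := leP 0 (z 0 0); last by left.
  by right; rewrite /= lt_def zs// radial_sqr_ge0.
move=> [/unit_ballE zB zs]; apply/slit_ballE; split => // z0.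
case: zs => /=; first by rewrite ltNge z0.
by move=> r0; rewrite gt_eqF.
Qed.

Lemma within_continuous_rV A F : (forall z, A z -> coord_differentiable F z) ->
  {within A, continuous F}.
Proof.
move=> dF; apply: continuous_in_subspaceT => z; rewrite inE => Az.
have Fz : Filter (nbhs z) := nbhs_filter z.
apply/(@cvgrPdist_le _ _ _ (nbhs z)) => e e0.
have H : \forall y \near z, forall i, `|F z 0 i - F y 0 i| <= e.
  apply: (@filter_forall _ _ (fun i y => `|F z 0 i - F y 0 i| <=
    e) (nbhs z) Fz) => i.
  have := differentiable_continuous (dF z Az i).
  by move=> /(@cvgrPdist_le _ _ _ (nbhs z)) /(_ e e0).
apply: filterS H => y Hy; apply: rV_norm_le; first exact: ltW.
by move=> i; rewrite !mxE.
Qed.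

Lemma homeomorphism_slit_ball :
  homeomorphism_with_inverse (unit_ball : set Rn) (unit_ball `\` slit)
    (parab_map \o fold_map) (unfold_map \o unparab_map).
Proof.
rewrite -/slit_ball; split.
- split=> z; first by move=> /fold_half_ball /parab_slit_ball.
  by move=> /unparab_half_ball /unfold_ball.
- by move=> z; rewrite inE => zB /=; rewrite parab_mapK ?fold_mapK//;
  exact: fold_half_ball.
- by move=> z; rewrite inE => zS /=; rewrite unfold_mapK ?unparab_mapK//;
  exact: unparab_half_ball.
- by apply: within_continuous_rV => z zB; apply: coord_differentiable_parab;
  exact: coord_differentiable_fold.
- apply: within_continuous_rV => z zS; apply: coord_differentiable_unfold; last
  exact: coord_differentiable_unparab.
  exact: unparab_half_ball.
Qed.

Lemma bdd_lipschitz_loc_lipschitz A (u : Rn -> R) : bdd_lipschitz A u ->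
    loc_lipschitz A u.
Proof.
move=> [M M0 MP] K cK KA; exists M => x y Kx Ay.
by have [] := MP x y (KA _ Kx) Ay.
Qed.

(** The constant C / a of [unfold_unparab_lipschitz] is continuous, hence
    bounded on compact subsets of the slit ball. *)
Lemma unfold_unparab_loc_lipschitz i :
  loc_lipschitz (slit_ball : set Rn) (fun z => (unfold_map \o unparab_map) z 0
    i).
Proof.
move=> K cK KS.
have [C C0 CP] := unfold_unparab_lipschitz.
pose b (z : Rn) : R := (unparab_height (z 0 0) (radial_sqr z))^-1.
have [|M M0 MP] := @continuous_compact_bounded _ _ b K cK.
  move=> z Kz; apply: differentiable_continuous; apply: differentiable_funV.
    have [z0 _] := unparab_half_ball (KS _ Kz).
    by rewrite axial0 in z0; rewrite gt_eqF.
  exact/differentiable_unparab_height/KS.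
exists (C * M) => z w Kz Sw.
apply: le_trans (CP i z w (KS _ Kz) Sw) _.
rewrite ler_wpM2r// ler_wpM2l// axial0.
exact: le_trans (ler_norm _) (MP z Kz).
Qed.

End regularity.

(** * Integrability of the differentials *)

Section integrals.
Import HBNNSimple.
Local Open Scope ereal_scope.

(** The integral of a nonnegative function is a supremum over the simple
    functions below it, so the comparison holds for arbitrary f.  It is applied
    to powers of the operator norm of a differential. *)
Lemma ge0_le_integral_setT d (T : measurableType d) (R : realType)
    (mu : {measure set T -> \bar R}) (D : set T) (f g : T -> \bar R) :
  (forall x, D x -> 0 <= f x <= g x) -> (forall x, 0 <= g x) ->
  \int[mu]_(x in D) f x <= \int[mu]_x g x.
Proof.
move=> fg g0; rewrite ge0_integralE; last by move=> x /fg /andP[].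
rewrite ge0_integralTE//; apply: ereal_sup_le => _ [h hf <-]; exists h => // x.
apply: le_trans (hf x) _; rewrite patchE; case: ifPn => [|_]; last exact: g0.
by rewrite inE => /fg /andP[].
Qed.

Lemma integral_cst_box (R : realType) n (r : 'I_n -> R) (c : R) :
  (forall i, 0 <= r i)%R -> (0 <= c)%R ->
  \int[@lebesgue_rV R n]_x (c * \1_(box r) x)%:E =
  (c * \prod_(i < n) (r i *+ 2))%:E.
Proof.
move=> r0 c0; have mb := measurable_box r.
under eq_integral do rewrite EFinM.
rewrite ge0_integralZl//; last by apply/measurable_EFinP;
  exact: measurable_indic.
rewrite integral_indic// setIT EFinM; congr (_ * _)%E.
exact: lebesgue_rV_box.
Qed.

Lemma geometric_nneseries_lt_pinfty (R : realType) (a z : R) :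
  (0 <= a)%R -> (0 <= z < 1)%R -> \sum_(k <oo) (a * z ^+ k)%:E < +oo.
Proof.
move=> a0 /andP[z0 z1].
have H : eseries (fun k => (a * z ^+ k)%:E) @ \oo --> (a * (1 - z)^-1)%:E.
  have -> : eseries (fun k => (a * z ^+ k)%:E) = EFin \o series (geometric a z).
    by apply/funext => k; rewrite /eseries /series /= -sumEFin.
  by apply: cvg_EFin; [exact: nearW|apply: cvg_geometric_series;
    rewrite ger0_norm].
by rewrite (cvg_lim _ H)// ltry.
Qed.

(** The box with these half-sides contains the points of the slit ball whose
    preimage under P has height at most 2^-k. *)
Definition dyadic_radii (R : realType) m (k : nat) (i : 'I_m.+1) : R :=
  (if i == ord0 then 1 else 2 / 2 ^+ k)%R.

(** The k-th term has integral C^p 2 4^m (2^p / 2^m)^k. *)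
Lemma dyadic_integral_lt_pinfty (R : realType) m (p C : R) :
  (0 <= C)%R -> (0 <= p)%R -> (p < m%:R)%R ->
  \int[@lebesgue_rV R m.+1]_x
     \sum_(k <oo) ((C * 2 ^+ k) `^ p * \1_(box (@dyadic_radii R m k)) x)%:E <
       +oo.
Proof.
move=> C0 p0 pm; set r := @dyadic_radii R m.
have r0 k i : (0 <= r k i)%R by rewrite /r /dyadic_radii; case: ifP => // _;
  rewrite divr_ge0// exprn_ge0.
have mb k := measurable_box (r k).
rewrite integral_nneseries//; last 2 first.
  by move=> k; apply/measurable_EFinP; apply: measurable_funM.
  by move=> k x _; rewrite lee_fin mulr_ge0// powR_ge0.
have Er k : (\prod_(i < m.+1) (r k i *+ 2) = 2 * (4 / 2 ^+ k) ^+ m)%R.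
  rewrite big_ord_recl /r /dyadic_radii eqxx; congr (_ * _)%R.
  rewrite (eq_bigr (fun=> 4 / 2 ^+ k))%R ?prodr_const ?card_ord// => j _.
  by rewrite -[LHS]mulr_natl mulrA -natrM.
rewrite (eq_eseriesr (g := fun k => ((C `^ p * 2 * 4 ^+ m) * (2 `^ p / 2 ^+ m)
  ^+ k)%:E)); last first.
  move=> k _; rewrite integral_cst_box ?powR_ge0// Er; congr EFin.
  have E : ((2 ^+ k) `^ p = (2 `^ p) ^+ k :> R)%R.
    by rewrite -powR_mulrn// -powRrM mulrC powRrM powR_mulrn//.
  rewrite powRM ?exprn_ge0// E !expr_div_n -!exprM (mulnC m k).
  by field; rewrite ?expf_neq0.
apply: geometric_nneseries_lt_pinfty.
  by rewrite !mulr_ge0// ?powR_ge0// exprn_ge0.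
rewrite divr_ge0 ?powR_ge0 ?exprn_ge0//= ltr_pdivrMr ?exprn_gt0// mul1r.
rewrite -powR_mulrn// /powR pnatr_eq0/= ltr_expR ltr_pM2r//.
by rewrite ln_gt0// ltr1n.
Qed.

End integrals.

Section sobolev_criterion.
Context {R : realType} {n : nat}.
Local Notation Rn := 'rV[R]_n.
Local Notation mu := (@lebesgue_rV R n).

Lemma enorm_coord (v : Rn) i : `|v 0 i| <= enorm v.
Proof.
rewrite -[leLHS]sqrtr_sqr /enorm ler_wsqrtr// (bigD1 i)//= lerDl sumr_ge0//
  => j _.
exact: sqr_ge0.
Qed.

Lemma enorm_le (v : Rn) (B : R) : 0 <= B -> (forall i, `|v 0 i| <= B) ->
    enorm v <= n%:R * B.
Proof.
move=> B0 vB; rewrite -[leRHS]ger0_norm ?mulr_ge0// -sqrtr_sqr ler_wsqrtr//.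
apply: (@le_trans _ _ (\sum_(i < n) B ^+ 2)).
  apply: ler_sum => i _; rewrite -[leLHS]real_normK ?num_real//.
  by rewrite ler_pXn2r ?nnegrE.
rewrite sumr_const card_ord -[leLHS]mulr_natl exprMn ler_wpM2r ?sqr_ge0//.
by rewrite -natrX ler_nat; case: n => // k; rewrite expnS leq_pmulr.
Qed.

Lemma opnorm_bound (A : 'M[R]_n) (M : R) : 0 <= M -> (forall i j, `|A i j| <=
    M) ->
  0 <= opnorm A <= n%:R ^+ 2 * M.
Proof.
move=> M0 AM.
have ub v : enorm v <= 1 -> enorm (v *m A) <= n%:R ^+ 2 * M.
  move=> v1; rewrite expr2 -mulrA; apply: enorm_le; first by rewrite mulr_ge0.
  move=> j; rewrite mxE (le_trans (ler_norm_sum _ _ _))//.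
  apply: (@le_trans _ _ (\sum_(i < n) M)); last
    by rewrite sumr_const card_ord mulr_natl.
  apply: ler_sum => i _; rewrite normrM -[leRHS]mul1r ler_pM//.
  exact: le_trans (enorm_coord v i) v1.
set S := [set enorm (v *m A) | v in [set v | enorm v <= 1]].
have e0 : enorm (0 : Rn) = 0.
  rewrite /enorm big1 ?sqrtr0// => i _; by rewrite mxE expr0n.
have S0 : S 0 by exists 0 => /=; rewrite ?mul0mx e0.
have Sub : ubound S (n%:R ^+ 2 * M) by move=> _ [v v1 <-]; exact: ub.
rewrite /opnorm -/S; apply/andP; split.
  by apply: ub_le_sup => //; exists (n%:R ^+ 2 * M).
by apply: ge_sup => //; exists 0.
Qed.

(** The weak differential is the classical one, and W is an integrable majorant
    of its operator norm to the power p; the factor n^2 compares this norm with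
    the largest entry. *)
Lemma sobolev_criterion (Omega : set Rn) (p : R) (h : Rn -> Rn) (W : Rn ->
    \bar R) :
  open Omega -> Omega `<=` unit_ball -> 0 <= p ->
  (forall x, Omega x -> enorm (h x) <= 1) ->
  (forall j, loc_lipschitz Omega (fun x => h x 0 j)) ->
  (forall x i j, Omega x -> derivable (fun x => h x 0 j) x (delta_mx 0 i)) ->
  (forall x, Omega x -> exists M : R, [/\ 0 <= M,
      forall i j, `|'D_(delta_mx 0 i) (fun x => h x 0 j) x| <= M &
      (((n%:R ^+ 2 * M) `^ p)%:E <= W x)%E]) ->
  (forall x, 0 <= W x)%E -> (\int[mu]_x W x < +oo)%E ->
  sobolev Omega p h.
Proof.
move=> oO OB p0 h1 hL hd hW W0 Wi.
exists (fun x => \matrix_(i, j) 'D_(delta_mx 0 i) (fun x => h x 0 j) x); split.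
- move=> i j; rewrite [X in weak_partial _ _ _ X](_ : _ =
  'D_(delta_mx 0 i) (fun x => h x 0 j)); last first.
    by apply/funext => x; rewrite mxE.
  by apply: loc_lipschitz_weak_partial => // x Ox; exact: hd.
- apply: (@le_lt_trans _ _ (\int[mu]_x (1 * \1_(box (fun=> 1)) x)%:E)%E).
    apply: ge0_le_integral_setT => [x Ox|x]; last first.
      by rewrite lee_fin mul1r.
    rewrite !lee_fin powR_ge0 /= indicE mem_set ?mulr1; last first.
      move=> i; apply: le_trans (enorm_coord _ _) _; exact/ltW/OB.
    apply: (@le_trans _ _ (1 `^ p)); last by rewrite powR1.
    by apply: ge0_ler_powR; rewrite ?nnegrE ?h1 ?ler01// sqrtr_ge0.
  by rewrite integral_cst_box// ltry.
- apply: le_lt_trans Wi; apply: ge0_le_integral_setT => // x Ox.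
  rewrite lee_fin powR_ge0 /=; have [M [M0 MP MW]] := hW x Ox.
  apply: le_trans MW; rewrite lee_fin.
  have /andP[? ?] : 0 <= opnorm (\matrix_(i, j) 'D_(delta_mx 0 i) (fun x => h x
    0 j) x : 'M[R]_n) <= n%:R ^+ 2 * M.
    by apply: opnorm_bound => // i j; rewrite mxE.
  by apply: ge0_ler_powR; rewrite ?nnegrE// mulr_ge0// exprn_ge0.
Qed.

End sobolev_criterion.

Section energies.
Context {R : realType} {m : nat}.
Local Notation Rn := 'rV[R]_m.+1.

Lemma norm_delta_le1 (i : 'I_m.+1) : `|delta_mx 0 i : Rn| <= 1.
Proof.
apply: rV_norm_le => // j; rewrite mxE /=.
by case: (_ == _); rewrite ?normr1 ?normr0.
Qed.

Lemma conformal_energy_parab_fold :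
  finite_conformal_energy (unit_ball : set Rn) (parab_map \o fold_map).
Proof.
have hL := bdd_lipschitz_parab (@bdd_lipschitz_fold R m).
have [M M0 MP] := bdd_lipschitz_map_uniform hL.
have dh z i : unit_ball z -> differentiable (fun x : Rn => (parab_map \o
  fold_map) x 0 i) z.
  by move=> zB; apply: coord_differentiable_parab;
    exact: coord_differentiable_fold.
apply: (@sobolev_criterion _ _ _ _ _
   (fun x => ((m.+1%:R ^+ 2 * M) `^ m.+1%:R * \1_(box (fun=> 1)) x)%:E)) => //.
- exact: open_unit_ball.
- by move=> z /fold_half_ball /parab_slit_ball [zB _]; exact: ltW.
- by move=> j; apply: bdd_lipschitz_loc_lipschitz; exact: hL.
- by move=> z i j zB; apply: diff_derivable; exact: dh.
- move=> z zB; exists M; split => //.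
    move=> i j; apply: (@le_trans _ _ (M * `|delta_mx 0 i : Rn|)).
      apply: normr_derive_le; first by apply: diff_derivable; exact: dh.
      have : nbhs z (unit_ball : set Rn) by apply: open_nbhs_nbhs; split => //;
        exact: open_unit_ball.
      by apply: filterS => w wB; exact: MP.
    by rewrite ler_piMr// norm_delta_le1.
  rewrite lee_fin indicE mem_set ?mulr1// => i.
  by apply: le_trans (enorm_coord _ _) _; exact: ltW.
- by move=> z; rewrite lee_fin mulr_ge0// powR_ge0.
- by rewrite integral_cst_box ?powR_ge0// ltry.
Qed.

Lemma exists_dyadic (a : R) : 0 < a <= 1 ->
  exists k : nat, 2^-1 / 2 ^+ k < a <= 1 / 2 ^+ k.
Proof.
move=> /andP[a0 a1].
have ex : exists k : nat, 2^-1 / 2 ^+ k < a.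
  have /cvgrPdist_lt /(_ a a0) : geometric (2^-1 : R) 2^-1 @ \oo --> 0.
    by apply: cvg_geometric; rewrite ger0_norm ?invr_ge0// invf_lt1// ltr1n.
  move=> [k _ /(_ k (leqnn k))] /=.
  rewrite sub0r normrN ger0_norm; last by rewrite mulr_ge0// ?exprn_ge0//
    invr_ge0.
  by rewrite exprVn; exists k.
case: (ex_minnP ex) => k ka kmin; exists k; rewrite ka /=.
case: k ka kmin => [|k] ka kmin; first by rewrite expr0 divr1.
rewrite leNgt; apply/negP => H; have := kmin k; rewrite ltnn => /implyP.
rewrite implybF => /negP; apply; apply: le_lt_trans H.
by rewrite exprS le_eqVlt; apply/orP; left; apply/eqP; field; rewrite expf_neq0.
Qed.

(** At a point whose preimage under P has height a, with 2^-(k+1) < a <= 2^-k,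
    the differential is at most C / a <= 2 C 2^k, and the point lies in the
    k-th box: the k-th term of the dyadic series is a majorant there. *)
Lemma sobolev_unfold_unparab (p : R) : 0 <= p -> p < m%:R ->
  sobolev (slit_ball : set Rn) p (unfold_map \o unparab_map).
Proof.
move=> p0 pm.
have [C C0 CP] := @unfold_unparab_lipschitz R m.
have df z i : slit_ball z -> differentiable (fun x : Rn => (unfold_map \o
  unparab_map) x 0 i) z.
  by move=> zS; apply: coord_differentiable_unfold;
    [exact: unparab_half_ball|exact: coord_differentiable_unparab].
have C1 : 0 <= m.+1%:R ^+ 2 * (2 * C) by rewrite mulr_ge0 ?exprn_ge0// mulr_ge0.
have := dyadic_integral_lt_pinfty C1 p0 pm.
set r := @dyadic_radii R m => Wi.
have t0 x k : (0 <= ((m.+1%:R ^+ 2 * (2 * C) * 2 ^+ k) `^ p * \1_(box (r k))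
  x)%:E)%E.
  by rewrite lee_fin mulr_ge0// powR_ge0.
apply: (sobolev_criterion _ _ _ _ _ _ _ _ Wi) => //.
- exact: open_slit_ball.
- by move=> z [].
- by move=> z /unparab_half_ball /unfold_ball; exact: ltW.
- exact: unfold_unparab_loc_lipschitz.
- by move=> z i j zS; apply: diff_derivable; exact: df.
- move=> z zS; have [a0 aB] := unparab_half_ball zS.
  exists (C / unparab_map z 0 0); have M0 : 0 <=
    C / unparab_map z 0 0 by rewrite divr_ge0// ltW.
  split => //.
    move=> i j; apply: (@le_trans _ _ (C / unparab_map z 0 0 * `|delta_mx 0 i :
      Rn|)).
      apply: normr_derive_le; first by apply: diff_derivable; exact: df.
      have : nbhs z (slit_ball : set Rn) by apply: open_nbhs_nbhs; split => //;
        exact: open_slit_ball.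
      apply: filterS => w wS; rewrite distrC [in leRHS]distrC; exact: CP.
    by rewrite ler_piMr// norm_delta_le1.
  have a1 : unparab_map z 0 0 <= 1 by exact: le_trans (ler_norm _) (ball_coord
    0 aB).
  have [k /andP[k1 k2]] := exists_dyadic (introT andP (conj a0 a1)).
  have zb : box (r k) z.
    move=> i; rewrite /r /dyadic_radii; case: ifPn => [_|i0];
      first by apply: ball_coord; case: zS.
    rewrite -(unparab_mapK zS) mxE (negbTE i0) normrM.
    apply: (@le_trans _ _ (parab_scale (unparab_map z 0 0) * 1)).
      rewrite ger0_norm; last by rewrite mulr_ge0// ltW.
      by rewrite ler_wpM2l ?ball_coord// mulr_ge0// ltW.
    by rewrite mulr1 /parab_scale ler_wpM2l// -[leRHS]mul1r.
  apply: (@le_trans _ _ (((m.+1%:R ^+ 2 * (2 * C) * 2 ^+ k) `^ p * \1_(box (r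
    k)) z)%:E)).
    rewrite lee_fin indicE mem_set// mulr1.
    apply: ge0_ler_powR; rewrite ?nnegrE//.
    + by rewrite mulr_ge0 ?exprn_ge0.
    + by rewrite mulr_ge0// exprn_ge0.
    rewrite -!mulrA !ler_wpM2l// mulrCA ler_wpM2l//.
    rewrite -[leLHS]mul1r ler_pdivrMr// -ler_pdivrMl; last
      by rewrite mulr_gt0// exprn_gt0.
    by rewrite mulr1 invfM ltW.
  apply: le_trans (nneseries_lim_ge k.+1 _) => //.
  by rewrite big_nat_recr//= leeDr// sume_ge0.
- by move=> z; apply: nneseries_ge0.
Qed.

End energies.

Theorem theorem1p9 (R : realType) (n : nat) (hn : (2 <= n)%N) (p : R)
    (hp1 : 1 <= p) (hpn : p < n%:R - 1) :
  exists h f : 'rV[R]_n -> 'rV[R]_n,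
    [/\ homeomorphism_with_inverse unit_ball (unit_ball `\` slit) h f,
        finite_conformal_energy unit_ball h &
        sobolev (unit_ball `\` slit) p f].
Proof.
case: n hn hpn => // m _; rewrite -natr1 addrK => pm.
exists (parab_map \o fold_map), (unfold_map \o unparab_map); split.
- exact: homeomorphism_slit_ball.
- exact: conformal_energy_parab_fold.
- by apply: sobolev_unfold_unparab => //; exact: le_trans hp1.
Qed.
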